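(* Let $g:S^1\to S^1$ be a $C^2$ expanding map. Then for every $C_0>0$ and every $\gamma>1$ there exist constants $K>0$ and $0<\lambda<1$ and, for every $\lambda_0$ with $\lambda^{1/2}<\lambda_0<1$, a constant $K'=K'(\lambda_0)>0$ (all depending only on $g,C_0,\gamma$, and $K'$ also on $\lambda_0$) such that the following holds. Let $f\in \mathrm{Exp}^2_\gamma(S^1)$ satisfy $d_{C^2}(f,g)<C_0$, let $h:S^1\to S^1$ be a homeomorphism with $h\circ f=g\circ h$, and suppose that for some $N\in\mathbb{N}$ we have $(f^N)'(p)=(g^N)'(h(p))$ for every $p\in\mathrm{Fix}(f^N)$. Then there exists a $C^2$ diffeomorphism $h_N:S^1\to S^1$ such that $d_{C^0}(h,h_N)\le K\lambda^N$ and such that, setting $f_N:=h_N^{-1}\circ g\circ h_N$, for every $\lambda_0$ with $\lambda^{1/2}<\lambda_0<1$ we have $d_{C^1}(f,f_N)\le K'(\lambda_0)\,\lambda_0^N$.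
   Context: $S^1=\mathbb{R}/\mathbb{Z}$. A $C^1$ map $f:S^1\to S^1$ is expanding if $\min_{x\in S^1}|f'(x)|>1$; this minimum is its minimum expansion rate. For $\gamma>1$, $\mathrm{Exp}^r_\gamma(S^1)$ is the set of $C^r$ expanding maps of $S^1$ with $|f'(x)|\ge\gamma$ for all $x$. $\mathrm{Fix}(f^N)$ is the set of fixed points of the $N$-th iterate $f^N$. For circle maps, $d_{C^0}(f,g)=\sup_x d(f(x),g(x))$ with $d$ the distance on $S^1$, and $d_{C^k}(f,g)=d_{C^0}(f,g)+\sum_{i=1}^k\sup_x|D^if(x)-D^ig(x)|$. *)

(* Defs.v *)
From HB Require Import structures.
From mathcomp Require Import all_boot all_order all_algebra.
From mathcomp Require Import all_classical all_reals all_analysis.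

Set Implicit Arguments.
Unset Strict Implicit.
Unset Printing Implicit Defensive.

Import Order.TTheory GRing.Theory Num.Theory.
Import numFieldNormedType.Exports.

Local Open Scope ring_scope.
Local Open Scope classical_set_scope.
Local Open Scope quotient_scope.

(* The circle S^1 = R/Z: the quotient of the additive group R by its subgroup
   of integers, with the quotient topology. *)
Definition circle (R : realType) : Type :=
  quotient_topology
    (Quotient.quot (GRing.ZmodClosed.clone R (@Num.int_num_subdef R) _)).

HB.instance Definition _ (R : realType) := Topological.on (circle R).
HB.instance Definition _ (R : realType) := generic_quotient.Quotient.on (circle R).

Section Circle.
Variable R : realType.
Local Notation S1 := (circle R).

Definition toS1 (x : R) : S1 := \pi_S1 x.

(* The quotient metric: the least distance between representatives. *)
Definition cdist (p q : S1) : R :=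
  inf [set r | exists x y : R, [/\ toS1 x = p, toS1 y = q & r = `|x - y|]].

Definition is_lift (f : S1 -> S1) (F : R -> R) :=
  continuous F /\ forall x : R, toS1 (F x) = f (toS1 x).

(* Every continuous [f] has a lift, unique up to an additive integer constant,
   so [derivc] below does not depend on the chosen one. *)
Definition lift_of (f : S1 -> S1) : R -> R := get [set F | is_lift f F].

(* The i-th derivative D^i f : S^1 -> R in the coordinate of R/Z, meaningful
   for i >= 1 only: at i = 0 the value depends on the chosen lift. *)
Definition derivc (i : nat) (f : S1 -> S1) (p : S1) : R :=
  derive1n i (lift_of f) (repr p).

(* F : R -> R is of class C^k. *)
Definition CkR (k : nat) (F : R -> R) :=
  (forall i, (i < k)%N -> forall x : R, derivable (derive1n i F) x 1) /\
  (forall i, (i <= k)%N -> continuous (derive1n i F)).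

Definition Ck (k : nat) (f : S1 -> S1) :=
  exists F : R -> R, is_lift f F /\ CkR k F.

Definition homeomorphism (h : S1 -> S1) :=
  continuous h /\
  exists k : S1 -> S1, [/\ cancel h k, cancel k h & continuous k].

(* [h] is a C^k diffeomorphism with inverse [hinv]. *)
Definition diffeomorphism (k : nat) (h hinv : S1 -> S1) :=
  [/\ cancel h hinv, cancel hinv h, Ck k h & Ck k hinv].

(* The infimum is a minimum when [f] is C^1. *)
Definition min_expansion_rate (f : S1 -> S1) : R :=
  inf (range (fun p => `|derivc 1 f p|)).

Definition expanding (f : S1 -> S1) :=
  Ck 1 f /\ 1 < min_expansion_rate f.

Definition Exp (r : nat) (gamma : R) : set (S1 -> S1) :=
  [set f | [/\ Ck r f, expanding f & forall p, gamma <= `|derivc 1 f p|]].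

Definition Fix (f : S1 -> S1) : set S1 := [set p | f p = p].

(* Suprema are taken in the extended reals, so that an unbounded difference
   gives +oo; for C^k maps the value is finite. *)
Definition dC0 (f g : S1 -> S1) : \bar R :=
  ereal_sup (range (fun p => (cdist (f p) (g p))%:E)).

Definition dC (k : nat) (f g : S1 -> S1) : \bar R :=
  (dC0 f g + \sum_(1 <= i < k.+1)
     ereal_sup (range (fun p => `|derivc i f p - derivc i g p|%:E)))%E.

End Circle.

(* Main.v *)
(** On lifts, [f] is an expanding map with finitely many contracting inverse
    branches, coded by words, and the conjugacy matches the branches of [f] with
    those of [g].  Let [mu_f] be the push-forward of Lebesgue measure under [f^k],
    and [mu_g] likewise; their densities are smooth with logarithmic Lipschitz
    constants independent of [k] (bounded distortion).  The map [h_N] is the smooth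
    one carrying [mu_f] to [mu_g], so only [mu_f J ~ mu_g (h J)] has to be shown,
    with an exponentially small error.

    For a cylinder [J] of level [m], with [m + k = N] and [m ~ N / 2], mixing gives
    [mu_f J ~ |J /\ f^-N J| / |J|].  The set [J /\ f^-N J] is a union of cylinders of
    level [N + m], each with relative length [1 / |(f^N)' p|], up to a factor
    [exp (O (gamma^-m))], at the point [p] of [Fix (f^N)] it contains.  These
    derivatives are the same for [g] at [h p], whence the claim.

    Finally [f_N = h_N^-1 g h_N] is exponentially [C^0]-close to [f = h^-1 g h] and
    has a bounded second derivative, so Landau's interpolation inequality gives
    [C^1]-closeness with the square root of the rate. *)
Require Import Defs.
From mathcomp Require Import all_boot all_order all_algebra.
From mathcomp Require Import all_classical all_reals all_analysis.
From mathcomp Require Import ring lra zify.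

Set Implicit Arguments.
Unset Strict Implicit.
Unset Printing Implicit Defensive.

Import Order.TTheory GRing.Theory Num.Theory.
Import numFieldNormedType.Exports.

Local Open Scope classical_set_scope.
Local Open Scope ring_scope.

(** * Calculus on the line *)
Section RealCalculus.
Variable R : realType.
Implicit Types (F G f g u v : R -> R) (x y c : R).

(** No measure is ever formed: a measure is represented by its distribution function, [transfer]
    acts on such functions, and [mu J] is an increment over [J]. Thus [h_N] becomes the monotone
    rearrangement of two explicit smooth functions. The obstacle shaping the estimates is that [h]
    is only continuous, so nothing can be differentiated across it: the two systems are compared
    solely through derivatives at matched periodic points and increments over matched cylinders.
    Errors on a cylinder are bounded by a multiple of its lengths for [f] and [g], since only such
    bounds survive summation over exponentially many cylinders. Splitting [N] between distortion and
    mixing costs one square root in the rate, already contained in [lambda]; the one visible in the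
    statement comes from interpolation. Every constant depends only on a lower bound for the
    expansion and an upper bound for the first two derivatives, and the [C^2] distance to [g] makes
    the latter uniform in [f]. *)

Definition derivf F f := forall x, is_derive x 1 F (f x).

Lemma derivf_ext F f F' f' : derivf F f -> F =1 F' -> f =1 f' -> derivf F' f'.
Proof. by move=> dF /funext <- /funext <-. Qed.

Lemma derivf_cst c : derivf (fun=> c) (fun=> 0).
Proof. by move=> x; exact: is_derive_cst. Qed.

Lemma derivf_id : derivf (fun x => x) (fun=> 1).
Proof. by move=> x; exact: is_derive_id. Qed.

Lemma derivfD F f G g : derivf F f -> derivf G g ->
  derivf (fun x => F x + G x) (fun x => f x + g x).
Proof. by move=> dF dG x; exact: is_deriveD. Qed.

Lemma derivfM F f G g : derivf F f -> derivf G g ->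
  derivf (fun x => F x * G x) (fun x => F x * g x + f x * G x).
Proof.
move=> dF dG x; have := @is_deriveM _ _ F G x 1 _ _ (dF x) (dG x).
by rewrite /GRing.scale/= [G x * _]mulrC.
Qed.

Lemma derivfZ c F f : derivf F f ->
  derivf (fun x => c * F x) (fun x => c * f x).
Proof.
move=> dF; apply: (derivf_ext (derivfM (derivf_cst c) dF)) => // x.
by rewrite mul0r addr0.
Qed.

Lemma derivfB F f G g : derivf F f -> derivf G g ->
  derivf (fun x => F x - G x) (fun x => f x - g x).
Proof.
move=> dF dG; apply: (derivf_ext (derivfD dF (derivfZ (-1) dG))) => x;
  by rewrite mulN1r.
Qed.

Lemma derivf_comp F f G g : derivf F f -> derivf G g ->
  derivf (fun x => F (G x)) (fun x => f (G x) * g x).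
Proof. by move=> dF dG x; apply: is_derive1_comp. Qed.

Lemma derivf_sum n (F f : 'I_n -> R -> R) : (forall i, derivf (F i) (f i)) ->
  derivf (fun x => \sum_i F i x) (fun x => \sum_i f i x).
Proof.
move=> dF x; have := @is_derive_sum _ _ _ n F x 1 (f^~ x) (fun i => dF i x).
by rewrite fct_sumE.
Qed.

Lemma derivf_affine (a b : R) : derivf (fun x => a * x + b) (fun=> a).
Proof.
apply: (derivf_ext (derivfD (derivfZ a derivf_id) (derivf_cst b))) => // x.
by rewrite mulr1 addr0.
Qed.

Lemma derivf_continuous F f : derivf F f -> continuous F.
Proof.
move=> dF x; apply/differentiable_continuous/derivable1_diffP.
by case: (dF x).
Qed.

Lemma derivf_derive1 F f : derivf F f -> derive1 F = f.
Proof. by move=> dF; apply/funext => x; rewrite derive1E; case: (dF x). Qed.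

Lemma derivf_unique F f g : derivf F f -> derivf F g -> f =1 g.
Proof. by move=> /derivf_derive1 <- /derivf_derive1 <-. Qed.

Lemma mvt_le F f x y : derivf F f -> x <= y ->
  exists2 c, x <= c <= y & F y - F x = f c * (y - x).
Proof.
move=> dF xy.
have [||c] := @MVT_segment _ F f x y xy; [by move=> *; exact: dF| |].
  by apply/continuous_subspaceT => z; exact: derivf_continuous dF z.
by rewrite in_itv/= => cxy ->; exists c.
Qed.

Lemma mvt F f x y : derivf F f ->
  exists c, [/\ Num.min x y <= c <= Num.max x y, `|c - x| <= `|y - x|,
     `|c - y| <= `|y - x| & F y - F x = f c * (y - x)].
Proof.
move=> dF; have [xy|/ltW xy] := leP x y.
  have [c /andP[xc cy] e] := mvt_le dF xy.
  exists c; split=> //; first by rewrite xc.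
    by rewrite !ger0_norm; lra.
  by rewrite ler0_norm ?ger0_norm; lra.
have [c /andP[xc cy] e] := mvt_le dF xy.
exists c; split=> //; first by rewrite xc.
- by rewrite !ler0_norm; lra.
- by rewrite ger0_norm ?ler0_norm; lra.
- by rewrite -opprB e; ring.
Qed.

Lemma derivf_lipschitz F f M : derivf F f -> (forall x, `|f x| <= M) ->
  forall x y, `|F x - F y| <= M * `|x - y|.
Proof.
move=> dF fM x y; have [c [_ _ _ ->]] := mvt y x dF.
by rewrite normrM ler_wpM2r.
Qed.

Lemma derivf_gt0_mono F f : derivf F f -> (forall x, 0 < f x) ->
  {mono F : x y / x <= y}.
Proof.
move=> dF f0; apply: le_mono => x y xy.
have [c _ e] := mvt_le dF (ltW xy).
by rewrite -subr_gt0 e mulr_gt0// subr_gt0.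
Qed.

Lemma derivf_inverse F f c : derivf F f -> 0 < c -> (forall x, c <= f x) ->
  exists G, [/\ cancel F G, cancel G F & derivf G (fun y => (f (G y))^-1)].
Proof.
move=> dF c0 cf.
have f0 x : 0 < f x by exact: lt_le_trans (cf x).
have mono := derivf_gt0_mono dF f0.
have surj y : exists x, F x = y.
  (* The slope is at least [c], so over a distance [t] the function moves by at least [|y - F 0|]:
     the values at [- t] and [t] bracket [y]. *)
  pose t := `|y - F 0| / c.
  have t0 : 0 <= t by rewrite divr_ge0// ltW.
  have ct : c * t = `|y - F 0| by rewrite mulrC divfK// gt_eqF.
  have hi : y <= F t.
    have [s _] := mvt_le dF t0; rewrite subr0 => e.
    have : c * t <= f s * t by rewrite ler_wpM2r.
    by have := ler_norm (y - F 0); lra.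
  have lo : F (- t) <= y.
    have [|s _] := @mvt_le F f (-t) 0 dF; first by lra.
    rewrite sub0r opprK => e.
    have : c * t <= f s * t by rewrite ler_wpM2r.
    by have := ler_norm (- (y - F 0)); rewrite normrN; lra.
  have [|||x _ <-] := @IVT _ F (- t) t y; last by exists x.
  - lra.
  - by apply: continuous_subspaceT => z; exact: derivf_continuous dF z.
  - by rewrite ge_min lo le_max hi orbT.
pose G y := projT1 (cid (surj y)).
have GK : cancel G F by move=> y; rewrite /G; case: cid.
have FK : cancel F G by move=> x; apply: (inc_inj mono); rewrite GK.
exists G; split=> // y; rewrite -{1}[y]GK.
apply: is_derive_inverse (dF _) _; last by rewrite gt_eqF.
  by near=> z; exact: FK.
by near=> z; exact: derivf_continuous dF z.
Unshelve. all: by end_near. Qed.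

(** Class [C^n] with existentially quantified derivatives, so that closure properties go by
    induction on [n]; [CkR_smooth] and [smooth_CkR] relate it to [CkR]. *)
Fixpoint smooth n F :=
  if n is m.+1 then exists2 f, derivf F f & smooth m f else continuous F.

Lemma smooth_ext n F G : smooth n F -> F =1 G -> smooth n G.
Proof. by move=> + /funext <-. Qed.

Lemma smoothS n F : smooth n.+1 F -> smooth n F.
Proof.
elim: n F => [|n IH] F [f dF sf]; first exact: derivf_continuous dF.
by exists f => //; exact: IH.
Qed.

Lemma smooth_derivf n F f : smooth n.+1 F -> derivf F f -> smooth n f.
Proof. by move=> [g dF sg] dF'; apply: (smooth_ext sg (derivf_unique dF dF')). Qed.

Lemma smooth_cst n c : smooth n (fun=> c).
Proof.
elim: n c => [|n IH] c; first exact: cst_continuous.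
by exists (fun=> 0) => //; exact: derivf_cst.
Qed.

Lemma smooth_id n : smooth n (fun x : R => x).
Proof.
case: n => [|n]; first by move=> x; exact: cvg_id.
by exists (fun=> 1); [exact: derivf_id|exact: smooth_cst].
Qed.

Lemma smoothD n F G : smooth n F -> smooth n G -> smooth n (fun x => F x + G x).
Proof.
elim: n F G => [|n IH] F G; first by move=> cF cG x; exact: (cvgD (cF x) (cG x)).
move=> [f dF sf] [g dG sg]; exists (fun x => f x + g x); first exact: derivfD.
exact: IH.
Qed.

Lemma smoothM n F G : smooth n F -> smooth n G -> smooth n (fun x => F x * G x).
Proof.
elim: n F G => [|n IH] F G; first by move=> cF cG x; exact: (cvgM (cF x) (cG x)).
move=> sF sG; move: (smoothS sF) (smoothS sG) => sF' sG'.
move: sF sG => [f dF sf] [g dG sg].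
exists (fun x => F x * g x + f x * G x); first exact: derivfM.
by apply: smoothD; exact: IH.
Qed.

Lemma smooth_sum n k (F : 'I_k -> R -> R) : (forall i, smooth n (F i)) ->
  smooth n (fun x => \sum_i F i x).
Proof.
move=> sF; elim: (index_enum _) => [|i s IH].
  by apply: (smooth_ext (smooth_cst n 0)) => x; rewrite big_nil.
by apply: (smooth_ext (smoothD (sF i) IH)) => x; rewrite big_cons.
Qed.

Lemma smooth_comp n F G : smooth n F -> smooth n G -> smooth n (fun x => F (G x)).
Proof.
elim: n F G => [|n IH] F G.
  by move=> cF cG x; exact: (@continuous_comp _ _ _ G F x (cG x) (cF (G x))).
move=> [f dF sf] sG; have sG' := smoothS sG; move: sG => [g dG sg].
exists (fun x => f (G x) * g x); first exact: derivf_comp.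
by apply: smoothM => //; exact: IH.
Qed.

Lemma smooth_affine n (a b : R) : smooth n (fun x => a * x + b).
Proof.
apply: smoothD; last exact: smooth_cst.
by apply: smoothM; [exact: smooth_cst|exact: smooth_id].
Qed.

Lemma smoothV n F : smooth n F -> (forall x, F x != 0) ->
  smooth n (fun x => (F x)^-1).
Proof.
move=> + F0; elim: n => [|n IH] sF; first by move=> x; apply: (cvgV (F0 x) (sF x)).
have sV := IH (smoothS sF); move: sF => [f dF sf].
exists (fun x => -1 * ((F x)^-1 * (F x)^-1) * f x); last first.
  by apply: smoothM => //; apply: smoothM; [exact: smooth_cst|exact: smoothM].
move=> x; have := is_deriveV (F0 x) (dF x).
by rewrite /GRing.scale/= mulN1r -expr2 exprVn.
Qed.

(** Bootstrap: the derivative of [G] is an expression in [f] and [G] itself, so each order of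
    smoothness of [G] yields the next. *)
Lemma smooth_inverse n F f G : smooth n F -> derivf F f -> (forall x, f x != 0) ->
  derivf G (fun y => (f (G y))^-1) -> smooth n G.
Proof.
move=> + dF f0 dG; elim: n => [|n IH] sF; first exact: derivf_continuous dG.
have sG := IH (smoothS sF).
exists (fun y => (f (G y))^-1) => //; apply: smoothV => //.
by apply: smooth_comp => //; exact: smooth_derivf dF.
Qed.

(** Over a step of length [s] the mean slope of [A] is at most [2 * c * s], and [a] differs from it
    by at most [B * s]. As [s <= 1], the Lipschitz bound is only asked at distances up to 1. *)
Lemma landau (A a : R -> R) c s B : derivf A a ->
  (forall x y, `|x - y| <= 1 -> `|a x - a y| <= B * `|x - y|) ->
  0 < s <= 1 -> (forall x, `|A x| <= c * (s * s)) ->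
  forall x, `|a x| <= (2 * c + B) * s.
Proof.
move=> dA aB /andP[s0 s1] Ac x.
have [|e /andP[xe ex]] := @mvt_le A a x (x + s) dA; first by rewrite lerDl ltW.
rewrite [x + s - x]addrC addKr => eqn.
have h1 : `|a x - a e| <= B * `|x - e|.
  by apply: aB; rewrite ler0_norm; lra.
have B0 : 0 <= B.
  have := aB 1 0; rewrite subr0 normr1 mulr1 => /(_ (lexx _)).
  exact: le_trans.
have h2 : `|a x - a e| <= B * s.
  by apply: (le_trans h1); rewrite ler_wpM2l// ler0_norm; lra.
have h3 : `|a e| <= 2 * c * s.
  rewrite -(ler_pM2r s0) -{1}[s]gtr0_norm// -normrM -eqn.
  apply: (le_trans (ler_normB _ _)); have := Ac x; have := Ac (x + s); lra.
rewrite mulrDl; apply: le_trans (lerD h3 h2).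
by rewrite -{1}[a x](subrK (a e)) addrC; exact: ler_normD.
Qed.

End RealCalculus.

(** * Mixing for the inverse branches *)
Lemma expR_sub1_le (R : realType) (C t : R) : 0 <= C -> 0 <= t -> t <= 1 ->
  expR (C * t) - 1 <= C * t * expR C.
Proof.
move=> C0 t0 t1; have h1 : 1 - C * t <= expR (- (C * t)) by exact: expR_ge1Dx.
have h2 : expR (C * t) <= expR C by rewrite ler_expR ler_piMr.
have h3 : expR (C * t) * expR (- (C * t)) = 1.
  by rewrite -expRD subrr expR0.
have h4 : expR (C * t) * (1 - C * t) <= 1.
  by rewrite -[leRHS]h3 ler_wpM2l ?expR_ge0.
have h5 : C * t * expR (C * t) <= C * t * expR C by rewrite ler_wpM2l ?mulr_ge0.
lra.
Qed.

(** * Logarithmic Lipschitz bounds *)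

Section LogLipschitz.
Variable R : realType.
Implicit Types (u v g : R -> R) (x y C : R).

(** Required in both orders for a positive [u], this says that [ln u] is [C]-Lipschitz between the
    two points. Being linear in [u], it passes to sums at once; being stated at a pair, it can be
    imposed on [[0, 1]] alone. *)
Definition loglip C u x y := u x <= expR (C * `|x - y|) * u y.

Lemma loglip_le C C' u x y : C <= C' -> 0 <= u y -> loglip C u x y -> loglip C' u x y.
Proof.
move=> CC' uy h; apply: (le_trans h); rewrite ler_wpM2r// ler_expR.
by rewrite ler_wpM2r.
Qed.

Lemma loglipM C C' u v x y : 0 <= u x -> 0 <= v x -> 0 <= v y ->
  loglip C u x y -> loglip C' v x y -> loglip (C + C') (fun z => u z * v z) x y.
Proof.
move=> ux vx vy hu hv; rewrite /loglip mulrDl expRD.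
by rewrite mulrACA ler_pM.
Qed.

Lemma loglipV C u x y : 0 < u x -> 0 < u y ->
  loglip C u y x -> loglip C (fun z => (u z)^-1) x y.
Proof.
move=> ux uy; rewrite /loglip distrC => h.
rewrite -(ler_pM2l ux) mulfV ?gt_eqF// mulrCA mulrA.
by rewrite -(ler_pM2r uy) mul1r mulfVK ?gt_eqF.
Qed.

Lemma loglip_sum n C (u : 'I_n -> R -> R) x y :
  (forall i, loglip C (u i) x y) -> loglip C (fun z => \sum_i u i z) x y.
Proof. by move=> h; rewrite /loglip mulr_sumr; apply: ler_sum => i _; exact: h. Qed.

Lemma loglip_comp C k u g x y : 0 <= C -> 0 <= u (g y) ->
  `|g x - g y| <= k * `|x - y| -> loglip C u (g x) (g y) ->
  loglip (C * k) (fun z => u (g z)) x y.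
Proof.
move=> C0 uy gk h; apply: (le_trans h); rewrite ler_wpM2r// ler_expR -mulrA.
by rewrite ler_wpM2l.
Qed.

Lemma loglip_lipschitz C M u : 0 <= C -> (forall x, 0 <= u x <= M) ->
  (forall x y, loglip C u x y) ->
  forall x y, `|x - y| <= 1 -> `|u x - u y| <= M * C * expR C * `|x - y|.
Proof.
move=> C0 u0; suff h x y : (forall x y, loglip C u x y) -> `|x - y| <= 1 ->
    u x - u y <= M * C * expR C * `|x - y|.
  move=> hu x y xy; have [_|_] := ger0P (u x - u y); first exact: h.
  by rewrite opprB distrC; apply: h; rewrite // distrC.
move=> /(_ x y) hu xy; set t := `|x - y| in hu xy *.
have t0 : 0 <= t by exact: normr_ge0.
have uM : u y <= M by have /andP[] := u0 y.
have u00 : 0 <= u y by have /andP[] := u0 y.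
have key := expR_sub1_le C0 t0 xy.
have h6 : u x - u y <= (expR (C * t) - 1) * u y by rewrite mulrBl mul1r lerB.
apply: (le_trans h6); apply: (le_trans (ler_wpM2r u00 key)).
rewrite mulrC; have -> : M * C * expR C * t = M * (C * t * expR C) by ring.
by rewrite ler_wpM2r// !mulr_ge0 ?expR_ge0.
Qed.

End LogLipschitz.

(** Convexity of the exponential between [- z] and [0]: the tangent at [- (t * z)] lies below the
    graph at both ends, and the two inequalities are averaged with weights [t] and [1 - t]. *)
Lemma expR_chord (R : realType) (t z : R) : 0 <= t <= 1 ->
  expR (- (t * z)) <= t * expR (- z) + (1 - t).
Proof.
move=> /andP[t0 t1]; set p := expR (- (t * z)).
have p0 : 0 <= p by exact: expR_ge0.
have tangent y : p * (1 + (y + t * z)) <= expR y.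
  have -> : y = (y + t * z) - t * z by ring.
  by rewrite expRD -/p mulrC -/p subrK ler_wpM2r// expR_ge1Dx.
have h1 := ler_wpM2l t0 (tangent (- z)).
have t1' : 0 <= 1 - t by rewrite subr_ge0.
have h2 := ler_wpM2l t1' (tangent 0); rewrite expR0 in h2.
have -> : p = t * (p * (1 + (- z + t * z))) + (1 - t) * (p * (1 + (0 + t * z))).
  by ring.
by rewrite lerD// (le_trans h2)// mulr1.
Qed.

Section Branches.
Variable R : realType.
Implicit Types (Q q U u V v : R -> R) (x y C : R).

(* [fold s] is the identity or the flip of [0, 1], so that the inverse branches
   of an orientation preserving and of an orientation reversing map are both
   [branch1 s Q i] for an increasing [Q]. *)
Definition fold (s : bool) x := if s then 1 - x else x.
Definition sg (s : bool) : R := (-1) ^+ s.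

Definition branch1 D s Q (i : 'I_D) x := Q (i%:R + fold s x).
Definition dbranch1 D s q (i : 'I_D) x := sg s * q (i%:R + fold s x).
Definition branch D s Q (w : seq 'I_D) x := foldr (branch1 s Q) x w.
Fixpoint dbranch D s Q q (w : seq 'I_D) x :=
  if w is i :: w' then dbranch1 s q i (branch s Q w' x) * dbranch s Q q w' x else 1.

(** Push-forward on distribution functions; the sign undoes the reversal caused by flipped branches.
    [dtransfer] is the matching Perron-Frobenius operator on densities. *)
Definition transfer D s Q U x := sg s * \sum_(i < D) U (branch1 s Q i x).
Definition dtransfer D s Q q u x :=
  \sum_(i < D) u (branch1 s Q i x) * q (i%:R + fold s x).

(** [Q] is the increasing inverse of a lift of degree [D] up to sign, fixing 0; the inverse branches
    are its restrictions to the unit intervals from 0 to [D]. [A] measures the distortion of one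
    branch. *)
Record branching D (kap A : R) Q q := Branching {
  br_zero : Q 0 = 0;
  br_per : forall y, Q (y + D%:R) = Q y + 1;
  br_deriv : derivf Q q;
  br_gt0 : forall y, 0 < q y;
  br_le : forall y, q y <= kap;
  br_loglip : forall x y, loglip A q x y }.

Definition I01 x := 0 <= x <= 1.

Lemma sgM s : sg s * sg s = 1.
Proof. by rewrite /sg -expr2 sqrr_sign. Qed.

Lemma norm_sg s : `|sg s| = 1.
Proof. by rewrite normr_sign. Qed.

Lemma fold01 s x : I01 x -> I01 (fold s x).
Proof. by case: s => //= /andP[h1 h2]; rewrite /I01; lra. Qed.

Lemma dist_fold s x y : `|fold s x - fold s y| = `|x - y|.
Proof.
case: s => //=; rewrite distrC; congr (`|_|); ring.
Qed.

Lemma foldB s (V : R -> R) :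
  sg s * (V (fold s 1) - V (fold s 0)) = V 1 - V 0.
Proof.
by case: s; rewrite /sg /= ?subrr ?subr0 ?expr1 ?mulN1r ?opprB ?mul1r.
Qed.

Lemma derivf_fold s : derivf (fold s) (fun=> sg s).
Proof.
case: s; rewrite /fold /sg /=; last exact: derivf_id.
apply: (derivf_ext (derivf_affine (-1) 1)) => x; last by rewrite expr1.
by rewrite mulN1r addrC.
Qed.

Lemma branch_cat D s Q (a b : seq 'I_D) x : branch s Q (a ++ b) x = branch s Q a (branch s Q b x).
Proof. exact: foldr_cat. Qed.

Variables (D : nat) (s : bool) (kap A : R) (Q q : R -> R).
Hypotheses (kap0 : 0 < kap) (kap1 : kap < 1) (A0 : 0 <= A).
Hypothesis br : branching D kap A Q q.

Local Notation psi1 := (@branch1 D s Q).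
Local Notation dpsi1 := (@dbranch1 D s q).
Local Notation psi := (@branch D s Q).
Local Notation dpsi := (@dbranch D s Q q).
Local Notation L := (transfer D s Q).
Local Notation l := (dtransfer D s Q q).
(** The geometric series [A * (1 + kap + kap^2 + ...)], a distortion constant for words of any
    length, and the fixed point of [C |-> C * kap + A]. *)
Let C1 := A / (1 - kap).

Lemma C1_ge0 : 0 <= C1.
Proof. by rewrite divr_ge0// subr_ge0 ltW. Qed.

Lemma C1E : C1 * (1 - kap) = A.
Proof. by rewrite divfK// subr_eq0 gt_eqF. Qed.

Lemma br_mono : {mono Q : x y / x <= y}.
Proof. exact: derivf_gt0_mono (br_deriv br) (br_gt0 br). Qed.

Lemma br_one : Q D%:R = 1.
Proof. by rewrite -[D%:R]add0r (br_per br) (br_zero br) add0r. Qed.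

Lemma D_gt0 : (0 < D)%N.
Proof.
rewrite lt0n; apply/eqP => D0; have := br_one; rewrite D0 (br_zero br).
by move/eqP; rewrite eq_sym oner_eq0.
Qed.

Lemma psi1_01 i x : I01 x -> I01 (psi1 i x).
Proof.
move=> /(@fold01 s)/andP[h1 h2]; rewrite /I01 -(br_zero br) -br_one !br_mono.
rewrite addr_ge0//=; apply: (@le_trans _ _ (i%:R + 1)); first by rewrite lerD2l.
by rewrite -(natrD _ _ 1) ler_nat addn1.
Qed.

Lemma psi_01 w x : I01 x -> I01 (psi w x).
Proof. by move=> hx; elim: w => //= i w IH; exact: psi1_01. Qed.

Lemma psi1_deriv i : derivf (psi1 i) (dpsi1 i).
Proof.
apply: (derivf_ext (derivf_comp (br_deriv br)
  (derivfD (derivf_cst i%:R) (derivf_fold s)))) => // x.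
by rewrite add0r mulrC.
Qed.

Lemma psi_deriv w : derivf (psi w) (dpsi w).
Proof.
elim: w => [|i w IH]; first exact: derivf_id.
exact: (derivf_comp (psi1_deriv i) IH).
Qed.

Lemma norm_dpsi1 (i : 'I_D) x : `|dpsi1 i x| = q (i%:R + fold s x).
Proof. by rewrite normrM norm_sg mul1r gtr0_norm// (br_gt0 br). Qed.

Lemma norm_dpsi_cons i w x :
  `|dpsi (i :: w) x| = q (i%:R + fold s (psi w x)) * `|dpsi w x|.
Proof. by rewrite /= normrM norm_dpsi1. Qed.

Lemma dpsi_sign w x : dpsi w x = sg s ^+ size w * `|dpsi w x|.
Proof.
elim: w => [|i w IH] /=; first by rewrite normr1 mulr1.
by rewrite normrM norm_dpsi1 {1}IH exprS /dbranch1; ring.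
Qed.

Lemma norm_dpsi_gt0 w x : 0 < `|dpsi w x|.
Proof.
elim: w => [|i w IH]; first by rewrite /= normr1.
by rewrite norm_dpsi_cons mulr_gt0// (br_gt0 br).
Qed.

Lemma norm_dpsi_le w x : `|dpsi w x| <= kap ^+ size w.
Proof.
elim: w => [|i w IH]; first by rewrite /= normr1.
rewrite norm_dpsi_cons exprS ler_pM//; first by rewrite ltW// (br_gt0 br).
exact: (br_le br).
Qed.

Lemma psi_contr w x y : `|psi w x - psi w y| <= kap ^+ size w * `|x - y|.
Proof. exact: derivf_lipschitz (psi_deriv w) (norm_dpsi_le w) x y. Qed.

Lemma psi1_contr i x y : `|psi1 i x - psi1 i y| <= kap * `|x - y|.
Proof. exact: (psi_contr [:: i]). Qed.

Lemma loglip_q (i : 'I_D) x y : loglip A (fun z => q (i%:R + fold s z)) x y.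
Proof.
rewrite -[A]mulr1; apply: (loglip_comp A0 (ltW (br_gt0 br _))); last exact: (br_loglip br).
by rewrite mul1r opprD addrACA subrr add0r dist_fold.
Qed.

Lemma loglip_dpsi w x y : loglip C1 (fun z => `|dpsi w z|) x y.
Proof.
(* The induction needs the partial geometric sum: a new outer letter contributes
   [A * kap ^+ size w], its distortion being read through the contraction [psi w]. *)
suff : loglip (C1 * (1 - kap ^+ size w)) (fun z => `|dpsi w z|) x y.
  apply: loglip_le => //; rewrite ler_piMr ?C1_ge0// gerBl.
  by rewrite exprn_ge0// ltW.
elim: w => [|i w IH]; first by rewrite /loglip /= subrr mulr0 mul0r expR0 mul1r.
have -> : C1 * (1 - kap ^+ size (i :: w)) =
    A * kap ^+ size w + C1 * (1 - kap ^+ size w).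
  by rewrite -C1E /= exprS; ring.
rewrite /loglip !norm_dpsi_cons.
have q0 z := ltW (br_gt0 br z).
apply: (@loglipM _ _ _ (fun z => q (i%:R + fold s (psi w z))) (fun z => `|dpsi w z|)) => //.
apply: (@loglip_comp _ _ _ (fun z => q (i%:R + fold s z))) => //.
  exact: psi_contr.
exact: loglip_q.
Qed.

Lemma transfer_deriv U u : derivf U u -> derivf (L U) (l u).
Proof.
move=> dU; apply: (derivf_ext (derivfZ (sg s)
  (derivf_sum (fun i => derivf_comp dU (psi1_deriv i))))) => // x.
rewrite mulr_sumr; apply: eq_bigr => i _; rewrite /dbranch1.
by rewrite mulrCA; congr (_ * _); rewrite mulrA sgM mul1r.
Qed.

Lemma transferB U x y :
  L U y - L U x = sg s * \sum_(i < D) (U (psi1 i y) - U (psi1 i x)).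
Proof. by rewrite -mulrBr -sumrB. Qed.

(** The branches map [[0, 1]] onto consecutive intervals from [Q 0 = 0] to [Q D = 1], so the sum
    telescopes. *)
Lemma sum_branches (V : R -> R) :
  sg s * \sum_(i < D) (V (psi1 i 1) - V (psi1 i 0)) = V 1 - V 0.
Proof.
rewrite mulr_sumr; have -> : V 1 - V 0 = V (Q D%:R) - V (Q 0%:R).
  by rewrite br_one (br_zero br).
rewrite -(telescope_sumr (fun i => V (Q i%:R)) (leq0n D)) big_mkord.
apply: eq_bigr => i _.
by rewrite (foldB s (fun z => V (Q (i%:R + z)))) addr0 natr1.
Qed.

Lemma transfer_norm U : L U 1 - L U 0 = U 1 - U 0.
Proof. by rewrite transferB sum_branches. Qed.

Lemma transfer_abs U x y : {homo U : x y / x <= y} ->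
  `|L U y - L U x| = \sum_(i < D) `|U (psi1 i y) - U (psi1 i x)|.
Proof.
move=> mU; wlog: x y / fold s x <= fold s y.
  move=> h; have [|/ltW] := leP (fold s x) (fold s y); first exact: h.
  move=> /h; rewrite distrC => ->.
  by apply: eq_bigr => i _; rewrite distrC.
move=> xy; rewrite transferB normrM norm_sg mul1r.
have h i : 0 <= U (psi1 i y) - U (psi1 i x).
  by rewrite subr_ge0 mU// br_mono lerD2l.
by rewrite ger0_norm ?sumr_ge0//; apply: eq_bigr => i _; rewrite ger0_norm.
Qed.

Lemma transfer_homo U : {homo U : x y / x <= y} -> {homo L U : x y / x <= y}.
Proof.
move=> mU x y xy; rewrite -subr_ge0 transferB mulr_sumr sumr_ge0// => i _.
rewrite /branch1 /sg /fold; case: s => /=.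
  rewrite expr1 mulN1r opprB subr_ge0 mU// br_mono lerD2l; lra.
by rewrite mul1r subr_ge0 mU// br_mono lerD2l.
Qed.

(** Composition with a branch multiplies the constant by [kap] and the weight adds [A]; any constant
    above [C1] is therefore strictly improved. *)
Lemma loglip_dtransfer C u x y : 0 <= C ->
  (forall i, loglip C u (psi1 i x) (psi1 i y)) ->
  (forall i, 0 <= u (psi1 i x)) -> (forall i, 0 <= u (psi1 i y)) ->
  loglip (C * kap + A) (l u) x y.
Proof.
move=> C0 hu ux uy; apply: loglip_sum => i; apply: loglipM => //.
- exact/ltW/(br_gt0 br).
- exact/ltW/(br_gt0 br).
- by apply: loglip_comp (psi1_contr i x y) _.
- exact: loglip_q.
Qed.

(** A probability on [[0, 1]] given by distribution function and density. Positivity and regularity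
    are required there only, because the lower bound behind [density_shrink] is available only
    there. *)
Record density C U u := Density {
  dens_deriv : derivf U u;
  dens_one : U 1 - U 0 = 1;
  dens_gt0 : forall x, I01 x -> 0 < u x;
  dens_loglip : forall x y, I01 x -> I01 y -> loglip C u x y }.

Lemma density_le C C' U u : C <= C' -> density C U u -> density C' U u.
Proof.
move=> CC' [dU U1 u0 ul]; split=> // x y hx hy.
by apply: loglip_le CC' _ (ul _ _ hx hy); rewrite ltW ?u0.
Qed.

Lemma dist01 x y : I01 x -> I01 y -> `|x - y| <= 1.
Proof. by move=> /andP[? ?] /andP[? ?]; rewrite ler_norml; lra. Qed.

Lemma density_bounds C U u x : 0 <= C -> density C U u -> I01 x ->
  expR (- C) <= u x <= expR C.
Proof.
move=> C0 [dU U1 u0 ul] hx.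
(* The total mass is 1, so the density equals 1 at some [c], and distortion from [c] bounds it
   everywhere. *)
have [c hc] := mvt_le dU ler01; rewrite U1 subr0 mulr1 => e.
have b y z : I01 y -> I01 z -> u y <= expR C * u z.
  move=> hy hz; apply: (le_trans (ul _ _ hy hz)).
  apply: ler_wpM2r; first exact/ltW/u0.
  by rewrite ler_expR ler_piMr// dist01.
apply/andP; split; last by rewrite -[leRHS]mulr1 e b.
have := b c x hc hx; rewrite -e -(ler_pM2l (expR_gt0 (- C))) mulr1 mulrA -expRD.
by rewrite addNr expR0 mul1r.
Qed.

Lemma dtransfer_gt0 u x : (forall i, 0 < u (psi1 i x)) -> 0 < l u x.
Proof.
move=> u0; rewrite /dtransfer (bigD1 (Ordinal D_gt0))//= ltr_pwDl//.
  by rewrite mulr_gt0 ?(br_gt0 br)// u0.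
by apply: sumr_ge0 => i _; rewrite mulr_ge0 ?ltW ?(br_gt0 br)// u0.
Qed.

Lemma density_transfer C U u : 0 <= C -> density C U u ->
  density (C * kap + A) (L U) (l u).
Proof.
move=> C0 du; have [dU U1 u0 ul] := du; split.
- exact: transfer_deriv.
- by rewrite transfer_norm.
- by move=> x hx; apply: dtransfer_gt0 => i; apply: u0; exact: psi1_01.
- move=> x y hx hy; apply: loglip_dtransfer => // i;
    by [apply: ul; exact: psi1_01|rewrite ltW// u0//; exact: psi1_01].
Qed.

Lemma dtransfer_affine (a b : R) u v x :
  l (fun z => a * u z + b * v z) x = a * l u x + b * l v x.
Proof.
by rewrite !mulr_sumr -big_split; apply: eq_bigr => i _ /=; ring.
Qed.

Lemma iter_dtransfer_affine k (a b : R) u v x :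
  iter k l (fun z => a * u z + b * v z) x = a * iter k l u x + b * iter k l v x.
Proof.
elim: k x => //= k IH x; rewrite -dtransfer_affine.
by apply: eq_bigr => i _; rewrite IH.
Qed.

(** With this choice one transfer brings the constant down to [C - (1 - kap)]. The slack pays for
    the subtraction of [a], which is the lower bound [expR (- C)] of a density times the relative
    slack [(1 - kap) / C]. *)
Let C := C1 + 1.
Let a := expR (- C) * (1 - kap) / C.

Lemma C_gt0 : 0 < C. Proof. by have := C1_ge0; rewrite /C; lra. Qed.

Lemma shrinkE : a * C = expR (- C) * (1 - kap).
Proof. by rewrite divfK// gt_eqF// C_gt0. Qed.

Lemma shrink_bounds : 0 < a < 1.
Proof.
have k1 : 0 < 1 - kap by rewrite subr_gt0.
have e1 : expR (- C) <= 1 by rewrite -expR0 ler_expR oppr_le0 ltW// C_gt0.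
have C11 : 1 <= C by rewrite lerDr C1_ge0.
rewrite divr_gt0 ?mulr_gt0 ?expR_gt0 ?C_gt0//=.
rewrite ltr_pdivrMr ?C_gt0// mul1r (lt_le_trans _ C11)//.
by rewrite (le_lt_trans (ler_piMl (ltW k1) e1))// gtrBl.
Qed.

Lemma contr_const : C * kap + A = C - (1 - kap).
Proof. by rewrite -C1E /C; ring. Qed.

(* Coupling: every transferred density dominates the constant [a], and what is
   left after removing it has the same regularity, so the part of two densities
   that has not been matched yet shrinks by [1 - a] at each step. *)
Lemma density_shrink U u : density (C * kap + A) U u ->
  density C (fun x => (1 - a)^-1 * (U x - a * x)) (fun x => (1 - a)^-1 * (u x - a)).
Proof.
have /andP[a0 a1] := shrink_bounds; have a1' : 0 < 1 - a by rewrite subr_gt0.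
have k1 : 0 < 1 - kap by rewrite subr_gt0.
have Cg := C_gt0.
move=> du; have [dU U1 u0 ul] := du.
have C'0 : 0 <= C * kap + A by rewrite addr_ge0// mulr_ge0// ltW.
have lb x : I01 x -> a * C <= u x * (1 - kap).
  move=> hx; rewrite shrinkE ler_wpM2r//; first exact: ltW.
  have /andP[+ _] := density_bounds C'0 du hx; apply: le_trans.
  by rewrite ler_expR lerN2 contr_const; lra.
split.
- apply: (derivf_ext (derivfZ (1 - a)^-1 (derivfB dU (derivfZ a (@derivf_id R))))) => // x.
  by rewrite mulr1.
- rewrite -mulrBr; have -> : U 1 - a * 1 - (U 0 - a * 0) = (U 1 - U 0) - a by ring.
  by rewrite U1 mulVf// gt_eqF.
- move=> x hx; rewrite mulr_gt0 ?invr_gt0// subr_gt0.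
  have := lb x hx; have : u x * (1 - kap) < u x * C.
    by rewrite ltr_pM2l ?u0// /C (@lt_le_trans _ _ 1) ?gtrBl// lerDr C1_ge0.
  by move=> h1 h2; rewrite -(ltr_pM2r Cg); exact: le_lt_trans h2 h1.
- move=> x y hx hy; rewrite /loglip mulrCA ler_pM2l ?invr_gt0//.
  set d := `|x - y|; have d0 : 0 <= d by exact: normr_ge0.
  have := ul x y hx hy; rewrite /loglip -/d contr_const => h.
  (* The goal is [u x - a <= E * (u y - a)]. Since [a <= t * u y], it follows from
     [u x <= (t + E * (1 - t)) * u y], and that factor dominates [expR ((C - (1 - kap)) * d)] by
     convexity. *)
  set t := (1 - kap) / C.
  have t0 : 0 <= t by rewrite divr_ge0 ?ltW.
  have t1 : t <= 1 by rewrite ler_pdivrMr// mul1r /C (@le_trans _ _ 1) ?gerBl ?(ltW kap0)// lerDr C1_ge0.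
  have tC : t * C = 1 - kap by rewrite divfK// gt_eqF.
  have uyt : a <= u y * t by rewrite -(ler_pM2r Cg) -[u y * t * C]mulrA tC lb.
  have uy : 0 < u y by exact: u0.
  have := @expR_chord R t (C * d); rewrite t0 t1 mulrA tC => /(_ isT).
  set E := expR (C * d); set w := expR (- ((1 - kap) * d)) => hw.
  have EV : E * expR (- (C * d)) = 1 by rewrite -expRD subrr expR0.
  have E1 : 1 <= E by rewrite -expR0 ler_expR mulr_ge0// ltW.
  have Ew : expR ((C - (1 - kap)) * d) = E * w by rewrite -expRD; congr expR; ring.
  have hEw : E * w <= t + E * (1 - t).
    have E0 : 0 <= E by exact: expR_ge0.
    apply: (le_trans (ler_wpM2l E0 hw)).
    by rewrite mulrDr mulrCA EV mulr1.
  have h1 := ler_wpM2r (ltW uy) hEw; rewrite Ew in h.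
  have E10 : 0 <= E - 1 by rewrite subr_ge0.
  have h2 := ler_wpM2r E10 uyt.
  lra.
Qed.

Lemma iter_transfer_deriv k U u : derivf U u -> derivf (iter k L U) (iter k l u).
Proof. by move=> dU; elim: k => //= k; exact: transfer_deriv. Qed.

Lemma iter_density k B U u : 0 <= B -> B * kap + A <= B -> density B U u ->
  density B (iter k L U) (iter k l u).
Proof.
move=> B0 hB du; elim: k => //= k IH.
by apply: density_le hB _; exact: density_transfer.
Qed.

Lemma iter_densityC k U u : density C U u -> density C (iter k L U) (iter k l u).
Proof.
apply: iter_density; first exact/ltW/C_gt0.
by rewrite contr_const gerBl subr_ge0 ltW.
Qed.

Lemma mixing k U u V v x : density C U u -> density C V v -> I01 x ->
  `|iter k l u x - iter k l v x| <= (1 - a) ^+ k * expR C.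
Proof.
have /andP[a0 a1] := shrink_bounds; have a1' : 0 < 1 - a by rewrite subr_gt0.
move=> + + hx; elim: k U u V v => [|k IH] U u V v du dv.
  have /andP[] := density_bounds (ltW C_gt0) du hx.
  have /andP[] := density_bounds (ltW C_gt0) dv hx.
  have := expR_gt0 (- C); rewrite expr0 mul1r ler_norml /=; lra.
(* The common part [a] cancels in the difference by linearity of the iterates, and the remainders,
   rescaled by [1 - a], are again densities with constant [C]. *)
have split_a w : l w = fun z => (1 - a) * ((1 - a)^-1 * (l w z - a)) + a * (fun=> 1) z.
  by apply/funext => z; rewrite mulrA mulfV ?gt_eqF// mul1r mulr1 subrK.
have shrunk W w : density C W w ->
    density C (fun z => (1 - a)^-1 * (L W z - a * z)) (fun z => (1 - a)^-1 * (l w z - a)).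
  by move=> dw; apply: density_shrink; exact: density_transfer (ltW C_gt0) dw.
rewrite !iterSr (split_a u) (split_a v) !iter_dtransfer_affine.
rewrite opprD addrACA subrr addr0 -mulrBr normrM gtr0_norm// exprS -mulrA.
by rewrite ler_pM2l//; exact: IH (shrunk _ _ du) (shrunk _ _ dv).
Qed.

(** The mean value theorem makes the error proportional to the length of the interval, as needed for
    summing over cylinders. *)
Lemma mixing_increments k U u V v x y :
  density C U u -> density C V v -> I01 x -> I01 y ->
  `|(iter k L U y - iter k L U x) - (iter k L V y - iter k L V x)| <=
    (1 - a) ^+ k * expR C * `|y - x|.
Proof.
move=> du dv hx hy.
have dUV := derivfB (iter_transfer_deriv k (dens_deriv du))
                    (iter_transfer_deriv k (dens_deriv dv)).
have [c [cxy _ _ e]] := mvt x y dUV.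
have hc : I01 c.
  move: hx hy cxy => /andP[x0 x1] /andP[y0 y1] /andP[c0 c1].
  rewrite /I01 (le_trans _ c0) ?le_min ?x0//=.
  by rewrite (le_trans c1)// ge_max x1.
have -> : iter k L U y - iter k L U x - (iter k L V y - iter k L V x) =
  iter k L U y - iter k L V y - (iter k L U x - iter k L V x) by ring.
rewrite e normrM; apply: ler_wpM2r; first exact: normr_ge0.
exact: mixing du dv hc.
Qed.

(** The sign of [dpsi w] depends on the length of [w] alone and cancels in the quotient; [c] is a
    point where the mean slope is attained. *)
Lemma psi_normalized w : psi w 1 - psi w 0 != 0 /\
  exists c, forall x, (psi w 1 - psi w 0)^-1 * dpsi w x = `|dpsi w c|^-1 * `|dpsi w x|.
Proof.
have [c _] := mvt_le (psi_deriv w) ler01; rewrite subr0 mulr1 => e.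
split; first by rewrite e -normr_gt0 norm_dpsi_gt0.
exists c => x; have sg0 : sg s ^+ size w != 0 by rewrite expf_neq0// /sg signr_eq0.
rewrite e; transitivity ((sg s ^+ size w * `|dpsi w c|)^-1 *
    (sg s ^+ size w * `|dpsi w x|)); first by rewrite -!dpsi_sign.
by rewrite invfM mulrACA mulVf// mul1r.
Qed.

Lemma psi_normalized_gt0 w x : 0 < (psi w 1 - psi w 0)^-1 * dpsi w x.
Proof.
by have [_ [c ->]] := psi_normalized w; rewrite mulr_gt0 ?invr_gt0 ?norm_dpsi_gt0.
Qed.

(** This is normalized Lebesgue measure on the cylinder of [w], pushed forward by as many steps as
    [w] has letters. Bounded distortion makes it a density with a constant independent of [w]. *)
Lemma density_psi w : density C1 (fun x => (psi w 1 - psi w 0)^-1 * psi w x)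
  (fun x => (psi w 1 - psi w 0)^-1 * dpsi w x).
Proof.
have [n0 [c E]] := psi_normalized w; split.
- exact: derivfZ (psi_deriv w).
- by rewrite -mulrBr mulVf.
- by move=> x _; exact: psi_normalized_gt0.
- move=> x y _ _; rewrite /loglip !E mulrCA ler_pM2l ?invr_gt0 ?norm_dpsi_gt0//.
  exact: loglip_dpsi.
Qed.

Lemma density_id : density C1 (fun x => x) (fun=> 1).
Proof.
split=> // [||x y _ _]; [exact: derivf_id|by rewrite subr0|].
by rewrite /loglip mulr1 -expR0 ler_expR mulr_ge0// C1_ge0.
Qed.

Lemma C1_fix : C1 * kap + A = C1.
Proof. by rewrite -C1E; ring. Qed.

Lemma C1_leC : C1 <= C. Proof. by rewrite lerDl. Qed.

Lemma iter_dtransfer1_gt0 k x : 0 < iter k l (fun=> 1) x.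
Proof. by elim: k x => //= k IH x; apply: dtransfer_gt0 => i; exact: IH. Qed.

(** Valid on the whole line, unlike the bounds carried by [density]: the map built from these
    functions is a lift. *)
Lemma loglip_iter_dtransfer1 k x y : loglip C1 (iter k l (fun=> 1)) x y.
Proof.
elim: k x y => [|k IH] x y /=.
  by rewrite /loglip mulr1 -expR0 ler_expR mulr_ge0// C1_ge0.
rewrite -C1_fix; apply: loglip_dtransfer => //; first exact: C1_ge0.
  by move=> i; exact/ltW/iter_dtransfer1_gt0.
by move=> i; exact/ltW/iter_dtransfer1_gt0.
Qed.

(** Moving [x] by 1 moves the index of every branch by one; the sum telescopes over a full turn, and
    [Q (y + D) = Q y + 1] closes it. *)
Lemma transfer_per U : (forall x, U (x + 1) = U x + 1) ->
  forall x, L U (x + 1) = L U x + 1.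
Proof.
move=> pU x; rewrite -[LHS](subrK (L U x)) transferB [RHS]addrC; congr (_ + _).
have tele y : \sum_(i < D) (U (Q (i%:R + 1 + y)) - U (Q (i%:R + y))) = 1.
  transitivity (\sum_(0 <= i < D) (U (Q (i.+1%:R + y)) - U (Q (i%:R + y)))).
    by rewrite big_mkord; apply: eq_bigr => i _; rewrite -natr1.
  rewrite (telescope_sumr (fun i => U (Q (i%:R + y)))) // add0r addrC.
  by rewrite addrC [D%:R + y]addrC (br_per br) pU; ring.
rewrite /branch1 /sg /fold; case: s => /=.
  rewrite expr1 mulN1r -sumrN -[RHS](tele (- x)); apply: eq_bigr => i _.
  by rewrite opprB; congr (U (Q _) - U (Q _)); ring.
rewrite mul1r -[RHS](tele x); apply: eq_bigr => i _.
by congr (U (Q _) - U (Q _)); ring.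
Qed.

Lemma transfer_smooth n U : smooth n Q -> smooth n U -> smooth n (L U).
Proof.
move=> sQ sU; apply: smoothM; first exact: smooth_cst.
apply: smooth_sum => i; apply: smooth_comp => //.
apply: (@smooth_comp _ _ Q) => //; apply: smoothD; first exact: smooth_cst.
rewrite /fold; case: s; last exact: smooth_id.
by apply: (smooth_ext (smooth_affine n (-1) 1)) => x; ring.
Qed.

(** The distribution function of Lebesgue measure pushed forward [k] times; none of the bounds
    depends on [k]. *)
Lemma iter_transfer_id k : let F := iter k L (fun x => x) in
  let f := iter k l (fun=> 1) in
  [/\ derivf F f, forall x, F (x + 1) = F x + 1,
      forall x, expR (- C1) <= f x <= expR C1,
      forall x y, loglip C1 f x y &
      forall n, smooth n Q -> smooth n F].
Proof.
move=> F f.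
have dF : derivf F f by apply: iter_transfer_deriv; exact: derivf_id.
have pF x : F (x + 1) = F x + 1.
  by rewrite /F; elim: k x {F f dF} => //= k IH x; exact: transfer_per.
split=> //; last 2 first.
- exact: loglip_iter_dtransfer1.
- move=> n sQ; rewrite /F; elim: k {F f dF pF} => [|k IH]; first exact: smooth_id.
  exact: transfer_smooth.
move=> x; have [|c /andP[xc cx]] := @mvt_le _ F f x (x + 1) dF.
  by rewrite lerDl.
rewrite pF => e; have {}e : f c = 1.
  by rewrite [x + 1]addrC addrK mulr1 in e; rewrite -e; ring.
have xc1 : `|x - c| <= 1 by rewrite ler_norml; lra.
have b : expR (C1 * `|x - c|) <= expR C1 by rewrite ler_expR ler_piMr ?C1_ge0.
have h1 := loglip_iter_dtransfer1 k x c.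
have h2 := loglip_iter_dtransfer1 k c x.
rewrite /loglip -/f e mulr1 in h1; rewrite /loglip -/f e distrC in h2.
rewrite (le_trans h1 b) andbT.
rewrite -(ler_pM2l (expR_gt0 C1)) -expRD subrr expR0 (le_trans h2)//.
by rewrite ler_wpM2r// ltW// iter_dtransfer1_gt0.
Qed.

(** * Cylinders, periodic points and gluing *)

Lemma psi_monotone w :
  {homo psi w : x y / x <= y} \/ {homo (fun x => - psi w x) : x y / x <= y}.
Proof.
have [h|h] : sg s ^+ size w = 1 \/ sg s ^+ size w = - 1.
- rewrite /sg -exprM -signr_odd; case: odd; [right|left]; by rewrite ?expr1.
- left=> x y; rewrite (derivf_gt0_mono (psi_deriv w))// => z.
  by rewrite dpsi_sign h mul1r norm_dpsi_gt0.
- right=> x y; have dN := derivfZ (-1) (psi_deriv w).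
  have := derivf_gt0_mono dN _ x y; rewrite !mulN1r => -> // z.
  by rewrite dpsi_sign h !mulN1r opprK norm_dpsi_gt0.
Qed.

Lemma psi_surj w x : psi w 0 <= x <= psi w 1 \/ psi w 1 <= x <= psi w 0 ->
  exists2 y, I01 y & psi w y = x.
Proof.
move=> hx; have [|||y] := @IVT _ (psi w) 0 1 x; last first.
- by rewrite in_itv /= => hy <-; exists y.
- by rewrite ge_min le_max; case: hx => /andP[-> ->] //=; rewrite !orbT.
- by apply: continuous_subspaceT => z; exact: derivf_continuous (psi_deriv w) z.
- exact: ler01.
Qed.

Lemma psi_fixpoint w : exists2 p, I01 p & psi w p = p.
Proof.
have d := derivfB (@derivf_id R) (psi_deriv w).
have [/andP[a0 a1] /andP[b0 b1]] : I01 (psi w 0) /\ I01 (psi w 1).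
  by split; apply: psi_01; rewrite /I01 ?lexx ler01.
have [|||y] := @IVT _ (fun x => x - psi w x) 0 1 0; last first.
- by rewrite in_itv /= => hy /eqP; rewrite subr_eq0 => /eqP e; exists y.
- by rewrite ge_min le_max sub0r oppr_le0 a0 subr_ge0 b1 orbT.
- by apply: continuous_subspaceT => z; exact: derivf_continuous d z.
- exact: ler01.
Qed.

(** [T] is the length of the cylinder of [b1 ++ b2 ++ b1] relative to that of [b1]. By the mean
    value theorem it is a value of [dpsi (b1 ++ b2)] at some [xi] in the cylinder of [b1], which
    contains [p] too. Both are within one diameter of the endpoint [psi b1 0], whence the factor
    2. *)
Lemma near_fixpoint (b1 b2 : seq 'I_D) p : I01 p -> psi (b1 ++ b2) p = p ->
  let T := `|(psi b1 1 - psi b1 0)^-1 * psi b1 (psi b2 (psi b1 1)) -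
             (psi b1 1 - psi b1 0)^-1 * psi b1 (psi b2 (psi b1 0))| in
  let E := expR (C1 * (2 * kap ^+ size b1)) in
  T <= E * `|dpsi (b1 ++ b2) p| /\ `|dpsi (b1 ++ b2) p| <= E * T.
Proof.
move=> hp ep T E; have [n0 _] := psi_normalized b1.
have [xi [_ h1 _]] := mvt (psi b1 0) (psi b1 1) (psi_deriv (b1 ++ b2)).
rewrite !branch_cat => e.
have -> : T = `|dpsi (b1 ++ b2) xi|.
  by rewrite /T -mulrBr e mulrCA mulVf// mulr1.
have hd : `|xi - p| <= 2 * kap ^+ size b1.
  have h01 : I01 (0 : R) by rewrite /I01 lexx ler01.
  have h11 : I01 (1 : R) by rewrite /I01 lexx ler01.
  have k0 : 0 <= kap ^+ size b1 by rewrite exprn_ge0// ltW.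
  have h2 : `|psi b1 1 - psi b1 0| <= kap ^+ size b1.
    by apply: (le_trans (psi_contr _ _ _)); rewrite ler_piMr// dist01.
  have h3 : `|psi b1 0 - p| <= kap ^+ size b1.
    rewrite -[p in leLHS]ep branch_cat; apply: (le_trans (psi_contr _ _ _)).
    by rewrite ler_piMr// dist01//; apply: psi_01.
  have -> : xi - p = (xi - psi b1 0) + (psi b1 0 - p) by ring.
  apply: (le_trans (ler_normD _ _)); lra.
have hE x y : `|x - y| <= 2 * kap ^+ size b1 -> expR (C1 * `|x - y|) <= E.
  by move=> ?; rewrite ler_expR ler_wpM2l// C1_ge0.
split; apply: le_trans (loglip_dpsi _ _ _) _; apply: ler_wpM2r => //; apply: hE => //.
by rewrite distrC.
Qed.

(** Cylinders are merged by removing the last letter. For the monotone [Z] absolute increments add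
    up exactly, while for [W] the triangle inequality suffices. *)
Lemma glue m (W Z : R -> R) : {homo Z : x y / x <= y} ->
  (forall w, size w = m -> `|W (psi w 1) - W (psi w 0)| <= `|Z (psi w 1) - Z (psi w 0)|) ->
  `|W 1 - W 0| <= Z 1 - Z 0.
Proof.
move=> mZ; elim: m => [|m IH] hm.
  by have := hm [::] erefl; rewrite /= [X in _ <= X]ger0_norm// subr_ge0 mZ.
apply: IH => w sw.
have -> : `|Z (psi w 1) - Z (psi w 0)| =
    \sum_(i < D) `|Z (psi w (psi1 i 1)) - Z (psi w (psi1 i 0))|.
  have [mw|mw] := psi_monotone w.
    rewrite -(transfer_norm (fun x => Z (psi w x))).
    by rewrite (@transfer_abs (fun x => Z (psi w x)))// => x y /mw /mZ.
  transitivity `|- Z (psi w 1) - - Z (psi w 0)|.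
    by rewrite -opprD normrN.
  rewrite -(transfer_norm (fun x => - Z (psi w x))).
  rewrite (@transfer_abs (fun x => - Z (psi w x))).
    by apply: eq_bigr => i _; rewrite -opprD normrN.
  by move=> x y /mw; rewrite !lerN2 => /mZ.
rewrite -(sum_branches (fun x => W (psi w x))) normrM norm_sg mul1r.
apply: (le_trans (ler_norm_sum _ _ _)); apply: ler_sum => i _.
by have := hm (w ++ [:: i]); rewrite size_cat sw addn1 !branch_cat; exact.
Qed.

(* The bound at an intermediate point [x] follows from [glue] for [W] stopped at
   [x], with an extra jump of size [om] at [x] added to [Z]. *)
Lemma glue_point m (W Z : R -> R) om x : {homo Z : x y / x <= y} -> I01 x ->
  (forall w, size w = m -> `|W (psi w 1) - W (psi w 0)| <= `|Z (psi w 1) - Z (psi w 0)|) ->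
  (forall w y z, size w = m -> I01 y -> I01 z -> `|W (psi w y) - W (psi w z)| <= om) ->
  `|W x - W 0| <= Z 1 - Z 0 + om.
Proof.
move=> mZ /andP[x0 x1] hW hom.
have om0 : 0 <= om.
  apply: le_trans (hom (nseq m (Ordinal D_gt0)) 0 0 _ _ _) => //.
    by rewrite size_nseq.
    by rewrite /I01 lexx ler01.
  by rewrite /I01 lexx ler01.
pose W' t := W (Num.min t x); pose Z' t := Z t + (if x <= t then om else 0).
have mZ' : {homo Z' : x y / x <= y}.
  move=> y z yz; rewrite /Z' lerD ?mZ//.
  by case: (leP x y) => [/le_trans/(_ yz) -> //|_]; case: ifP.
have : `|W' 1 - W' 0| <= Z' 1 - Z' 0.
  apply: (@glue m) => // w sw.
  (* To the right of [x] the stopped function is constant, and to the left nothing has changed. Only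
     a cylinder with [l < x <= r] sees the jump of [Z'], which absorbs [om]. *)
  suff key l r : l <= r -> `|W r - W l| <= `|Z r - Z l| ->
      (l < x <= r -> `|W x - W l| <= om) -> `|W' r - W' l| <= `|Z' r - Z' l|.
    have h0 : I01 (0 : R) by rewrite /I01 lexx ler01.
    have h1 : I01 (1 : R) by rewrite /I01 lexx ler01.
    have [lr|/ltW lr] := leP (psi w 0) (psi w 1).
      apply: key => // [|/andP[/ltW ax bx]]; first exact: hW.
      have [|y hy <-] := @psi_surj w x; first by left; rewrite ax.
      exact: hom.
    rewrite distrC [X in _ <= X]distrC; apply: key => // [|/andP[/ltW ax bx]].
      by rewrite distrC [X in _ <= X]distrC; exact: hW.
    have [|y hy <-] := @psi_surj w x; first by right; rewrite ax.
    exact: hom.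
  move=> lr h1 h2; rewrite /W' /Z'.
  have [xl|] := boolP (x <= l).
    by rewrite !min_r ?(le_trans xl lr)// subrr normr0.
  rewrite -ltNge => lx; have [xr|] := boolP (x <= r).
    rewrite (min_l (ltW lx)) (min_r xr) addr0; apply: (le_trans (h2 _)).
      by rewrite lx.
    have h3 : Z l <= Z r by exact: mZ.
    by rewrite addrAC ger0_norm; move: om0; lra.
  by rewrite -ltNge => rx; rewrite (min_l (ltW lx)) (min_l (ltW rx)) !addr0.
rewrite /W' /Z' x1 (min_r x1) (min_l x0) => /le_trans; apply.
rewrite opprD addrACA lerD2l; case: ifP => _; lra.
Qed.

End Branches.

(** * Comparison of two conjugate systems *)
(** For a monotone function the absolute increment of an iterated transfer is the sum of the
    absolute increments over all words of length [k], so a comparison word by word is enough. *)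
Lemma iter_transfer_compare (R : realType) D s (kap A : R) Q q Q' q' k
    (U V : R -> R) c x y x' y' :
  branching D kap A Q q -> branching D kap A Q' q' ->
  {homo U : x y / x <= y} -> {homo V : x y / x <= y} ->
  (forall w : seq 'I_D, size w = k ->
    `|U (branch s Q w y) - U (branch s Q w x)| <=
    c * `|V (branch s Q' w y') - V (branch s Q' w x')|) ->
  `|iter k (transfer D s Q) U y - iter k (transfer D s Q) U x| <=
  c * `|iter k (transfer D s Q') V y' - iter k (transfer D s Q') V x'|.
Proof.
move=> br br'; elim: k U V => [|k IH] U V mU mV h; first exact: (h [::]).
rewrite !iterSr; apply: IH => [||w sw]; [exact: transfer_homo br _ mU|
  exact: transfer_homo br' _ mV|].
rewrite (transfer_abs s br)// (transfer_abs s br')// mulr_sumr.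
by apply: ler_sum => i _; apply: (h (i :: w)); rewrite /= sw.
Qed.

Section Comparison.
Variable R : realType.
Variables (D : nat) (s : bool) (kap A : R) (Qf qf Qg qg : R -> R).
Hypotheses (kap0 : 0 < kap) (kap1 : kap < 1) (A0 : 0 <= A).
Hypotheses (brf : branching D kap A Qf qf) (brg : branching D kap A Qg qg).

Local Notation psif := (@branch R D s Qf).
Local Notation psig := (@branch R D s Qg).
Local Notation dpsif := (@dbranch R D s Qf qf).
Local Notation dpsig := (@dbranch R D s Qg qg).
Local Notation Lf := (transfer D s Qf).
Local Notation Lg := (transfer D s Qg).
Local Notation C1 := (A / (1 - kap)).
Local Notation C := (A / (1 - kap) + 1).
Local Notation shrink := (expR (- C) * (1 - kap) / C).

Variable H : R -> R.
Hypotheses (H_mono : {mono H : x y / x <= y}) (H_zero : H 0 = 0) (H_one : H 1 = 1).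
Hypothesis H_branch : forall (i : 'I_D) x,
  H (branch1 s Qf i x) = branch1 s Qg i (H x).

Lemma H_psi w x : H (psif w x) = psig w (H x).
Proof. by elim: w => //= i w IH; rewrite H_branch IH. Qed.

Lemma H01 x : I01 x -> I01 (H x).
Proof. by move=> /andP[x0 x1]; rewrite /I01 -H_zero -H_one !H_mono x0. Qed.

Variables (m k : nat).
Hypothesis matched : forall w p, size w = (m + k)%N -> I01 p -> psif w p = p ->
  `|dpsif w p| = `|dpsig w (H p)|.

Let xf w := psif w 0.
Let yf w := psif w 1.
Let xg w := psig w 0.
Let yg w := psig w 1.
(** Increments of [iter k Lf (Uf w)] over the cylinder [J] of [w] have absolute value
    [|J /\ f^-N J| / |J|]; similarly for [Ug]. *)
Let Uf w x := (yf w - xf w)^-1 * psif w x.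
Let Ug w x := (yg w - xg w)^-1 * psig w x.
Let E := expR (C1 * (2 * kap ^+ m)).

Let h0 : I01 (0 : R). Proof. by rewrite /I01 lexx ler01. Qed.
Let h1 : I01 (1 : R). Proof. by rewrite /I01 lexx ler01. Qed.

Lemma increments_compare w : size w = m ->
  let Xf := `|iter k Lf (Uf w) (yf w) - iter k Lf (Uf w) (xf w)| in
  let Xg := `|iter k Lg (Ug w) (yg w) - iter k Lg (Ug w) (xg w)| in
  Xf <= E * E * Xg /\ Xg <= E * E * Xf.
Proof.
move=> sw Xf Xg.
have E0 : 0 <= E by exact: expR_ge0.
have mUf : {homo Uf w : x y / x <= y}.
  move=> x y; rewrite (derivf_gt0_mono (derivfZ (yf w - xf w)^-1 (psi_deriv s brf w)))//.
  exact: (psi_normalized_gt0 s brf).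
have mUg : {homo Ug w : x y / x <= y}.
  move=> x y; rewrite (derivf_gt0_mono (derivfZ (yg w - xg w)^-1 (psi_deriv s brg w)))//.
  exact: (psi_normalized_gt0 s brg).
(* [t] is the derivative of the inverse branch at its fixed point [p], equal to that for [g] at
   [H p]. Each system is within a factor [E] of it, which gives [E * E]. *)
have pts b : size b = k ->
    exists t, [/\ `|Uf w (psif b (yf w)) - Uf w (psif b (xf w))| <= E * t,
      t <= E * `|Uf w (psif b (yf w)) - Uf w (psif b (xf w))|,
      `|Ug w (psig b (yg w)) - Ug w (psig b (xg w))| <= E * t &
      t <= E * `|Ug w (psig b (yg w)) - Ug w (psig b (xg w))|].
  move=> sb; have [p hp ep] := psi_fixpoint s brf (w ++ b).
  have [f1 f2] := near_fixpoint kap0 kap1 A0 brf hp ep.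
  have epg : psig (w ++ b) (H p) = H p by rewrite -H_psi ep.
  have [g1 g2] := near_fixpoint kap0 kap1 A0 brg (H01 hp) epg.
  rewrite -matched ?size_cat ?sw ?sb// in g1 g2; rewrite sw in f1 f2.
  by exists `|dpsif (w ++ b) p|.
split.
- apply: (iter_transfer_compare brf brg) => // b /pts[t [f1 f2 g1 g2]].
  by apply: (le_trans f1); rewrite -mulrA ler_wpM2l.
- apply: (iter_transfer_compare brg brf) => // b /pts[t [f1 f2 g1 g2]].
  by apply: (le_trans g1); rewrite -mulrA ler_wpM2l.
Qed.

Let Phif := iter k Lf (fun x => x).
Let Phig := iter k Lg (fun x => x).
(** The first term is the mixing error. The second bounds [E * E - 1], the relative error at the
    periodic points, times the bound [expR C] on densities. *)
Let delta := (1 - shrink) ^+ k * expR C +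
  4 * C1 * kap ^+ m * expR (4 * C1) * expR C.

Let C1_0 : 0 <= C1. Proof. exact: C1_ge0. Qed.
Let C_0 : 0 <= C. Proof. by rewrite addr_ge0. Qed.
Let km0 : 0 <= kap ^+ m. Proof. by rewrite exprn_ge0// ltW. Qed.
Let km1 : kap ^+ m <= 1. Proof. by rewrite exprn_ile1// ltW. Qed.

Let delta_ge0 : 0 <= delta.
Proof.
have /andP[_ a1] := shrink_bounds kap0 kap1 A0.
rewrite addr_ge0// mulr_ge0 ?expR_ge0 ?exprn_ge0 ?subr_ge0 ?(ltW a1)//.
by rewrite mulr_ge0 ?expR_ge0// mulr_ge0// mulr_ge0.
Qed.

Lemma iter_transfer_homo j Q q (U : R -> R) : branching D kap A Q q ->
  {homo U : x y / x <= y} -> {homo iter j (transfer D s Q) U : x y / x <= y}.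
Proof. by move=> br mU; elim: j => //= j IH; exact: (transfer_homo s br IH). Qed.

Lemma iter_density_lipschitz Q q U u x y : branching D kap A Q q ->
  density C1 U u -> I01 x -> I01 y ->
  `|iter k (transfer D s Q) U y - iter k (transfer D s Q) U x| <= expR C * `|y - x|.
Proof.
move=> br dU hx hy.
have dk := iter_densityC s kap1 A0 br k (density_le (C1_leC kap A) dU).
have [c [cxy _ _ ->]] := mvt x y (dens_deriv dk).
have hc : I01 c.
  move: hx hy cxy => /andP[x0 x1] /andP[y0 y1] /andP[c0 c1].
  rewrite /I01 (le_trans _ c0) ?le_min ?x0//=.
  by rewrite (le_trans c1)// ge_max x1.
rewrite normrM ler_wpM2r// ger0_norm; last exact/ltW/(dens_gt0 dk).
by have /andP[] := density_bounds C_0 dk hc.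
Qed.

Lemma dist_le_of_ratio (c X Y : R) : 1 <= c -> 0 <= X -> 0 <= Y ->
  X <= c * Y -> Y <= c * X -> `|X - Y| <= (c - 1) * (X + Y).
Proof.
move=> hc X0 Y0 XY YX; have hX : 0 <= (c - 1) * X by rewrite mulr_ge0// subr_ge0.
have hY : 0 <= (c - 1) * Y by rewrite mulr_ge0// subr_ge0.
by rewrite ler_norml; apply/andP; split; lra.
Qed.

Lemma cylinder_estimate w : size w = m ->
  `|(Phif (yf w) - Phif (xf w)) - (Phig (yg w) - Phig (xg w))| <=
    delta * (`|yf w - xf w| + `|yg w - xg w|).
Proof.
move=> sw; have [ratio1 ratio2] := increments_compare sw.
have df := density_psi s kap0 kap1 A0 brf w.
have dg := density_psi s kap0 kap1 A0 brg w.
have [hxf hyf] : I01 (xf w) /\ I01 (yf w) by split; exact: (psi_01 s brf).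
have [hxg hyg] : I01 (xg w) /\ I01 (yg w) by split; exact: (psi_01 s brg).
have up U u : density C1 U u -> density C U u := density_le (C1_leC kap A).
have id1 := up _ _ (density_id kap1 A0).
have mf := mixing_increments s kap0 kap1 A0 brf k (up _ _ df) id1 hxf hyf.
have mg := mixing_increments s kap0 kap1 A0 brg k (up _ _ dg) id1 hxg hyg.
have bf := iter_density_lipschitz brf df hxf hyf.
have bg := iter_density_lipschitz brg dg hxg hyg.
have EE : 1 <= E * E.
  have t0 : 0 <= C1 * (2 * kap ^+ m) by rewrite mulr_ge0// mulr_ge0.
  by rewrite -expRD -[leLHS]expR0 ler_expR addr_ge0.
have EE1 : E * E - 1 <= 4 * C1 * kap ^+ m * expR (4 * C1).
  have C40 : 0 <= 4 * C1 by rewrite mulr_ge0.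
  apply: le_trans (expR_sub1_le C40 km0 km1).
  by rewrite -expRD lerD2r ler_expR; lra.
move: ratio1 ratio2 mf mg bf bg; rewrite -/(Uf w) -/(Ug w) -/Phif -/Phig.
set Xf := iter k Lf (Uf w) (yf w) - iter k Lf (Uf w) (xf w).
set Xg := iter k Lg (Ug w) (yg w) - iter k Lg (Ug w) (xg w).
move=> ratio1 ratio2 mf mg bf bg.
have Hx : H (xf w) = xg w by rewrite H_psi H_zero.
have Hy : H (yf w) = yg w by rewrite H_psi H_one.
have mUf : {homo Uf w : x y / x <= y}.
  move=> x y; rewrite (derivf_gt0_mono (derivfZ (yf w - xf w)^-1 (psi_deriv s brf w)))//.
  exact: (psi_normalized_gt0 s brf).
have mUg : {homo Ug w : x y / x <= y}.
  move=> x y; rewrite (derivf_gt0_mono (derivfZ (yg w - xg w)^-1 (psi_deriv s brg w)))//.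
  exact: (psi_normalized_gt0 s brg).
(* [H] preserves order, so both increments have the same sign and the comparison of absolute values
   is one of the increments themselves. *)
have same : `|Xf - Xg| = `| `|Xf| - `|Xg| |.
  have [lef|/ltW lef] := leP (xf w) (yf w);
    have := lef; rewrite -H_mono Hx Hy => leg.
    have Xf0 : 0 <= Xf by rewrite subr_ge0; exact: iter_transfer_homo brf mUf _ _ lef.
    have Xg0 : 0 <= Xg by rewrite subr_ge0; exact: iter_transfer_homo brg mUg _ _ leg.
    by rewrite (ger0_norm Xf0) (ger0_norm Xg0).
  have Xf0 : Xf <= 0 by rewrite subr_le0; exact: iter_transfer_homo brf mUf _ _ lef.
  have Xg0 : Xg <= 0 by rewrite subr_le0; exact: iter_transfer_homo brg mUg _ _ leg.
  by rewrite (ler0_norm Xf0) (ler0_norm Xg0) -opprD normrN.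
have mid : `|Xf - Xg| <= 4 * C1 * kap ^+ m * expR (4 * C1) * expR C *
    (`|yf w - xf w| + `|yg w - xg w|).
  rewrite same; apply: (le_trans (dist_le_of_ratio EE _ _ ratio1 ratio2)) => //.
  have h2 : `|Xf| + `|Xg| <= expR C * (`|yf w - xf w| + `|yg w - xg w|).
    by rewrite mulrDr lerD.
  apply: (le_trans (ler_wpM2r _ EE1)); first by rewrite addr_ge0.
  rewrite -(mulrA _ (expR C)); apply: ler_wpM2l => //.
  by rewrite mulr_ge0 ?expR_ge0// mulr_ge0// mulr_ge0.
have -> : Phif (yf w) - Phif (xf w) - (Phig (yg w) - Phig (xg w)) =
   (Xg - (Phig (yg w) - Phig (xg w))) + (Xf - Xg) -
   (Xf - (Phif (yf w) - Phif (xf w))) by ring.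
rewrite /delta mulrDl mulrDr.
apply: (le_trans (ler_normB _ _)).
have := ler_normD (Xg - (Phig (yg w) - Phig (xg w))) (Xf - Xg).
lra.
Qed.

(** Gluing with [Z x = delta * (x + H x)], whose increment over a cylinder of [f] is [delta] times
    the signed sum of the lengths for [f] and [g]; over [[0, 1]] it amounts to [2 * delta]. The last
    term is the oscillation inside one cylinder. *)
Lemma transfer_id_close x : I01 x ->
  `|(Phif x - Phif 0) - (Phig (H x) - Phig 0)| <=
  2 * delta + 2 * (expR C1 * kap ^+ m).
Proof.
move=> hx; pose W x := Phif x - Phig (H x); pose Z x := delta * (x + H x).
have -> : (Phif x - Phif 0) - (Phig (H x) - Phig 0) = W x - W 0.
  by rewrite /W H_zero; ring.
have -> : 2 * delta = Z 1 - Z 0 by rewrite /Z H_one H_zero; ring.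
have mZ : {homo Z : x y / x <= y}.
  by move=> a b ab; rewrite ler_wpM2l// lerD// H_mono.
apply: (@glue_point R D s _ _ _ _ brf m W Z) => // [w sw|w y z sw hy hz].
  rewrite /W /Z !H_psi H_zero H_one -mulrBr normrM ger0_norm//.
  have -> : psif w 1 + psig w 1 - (psif w 0 + psig w 0) =
    (yf w - xf w) + (yg w - xg w) by rewrite /yf /xf /yg /xg; ring.
  have -> : Phif (psif w 1) - Phig (psig w 1) - (Phif (psif w 0) - Phig (psig w 0))
    = (Phif (yf w) - Phif (xf w)) - (Phig (yg w) - Phig (xg w)).
    by rewrite /yf /xf /yg /xg; ring.
  apply: (le_trans (cylinder_estimate sw)); rewrite ler_wpM2l//.
  have Hx : H (xf w) = xg w by rewrite H_psi H_zero.
  have Hy : H (yf w) = yg w by rewrite H_psi H_one.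
  have [lef|/ltW lef] := leP (xf w) (yf w);
    have := lef; rewrite -H_mono Hx Hy => leg.
    by rewrite !ger0_norm//; lra.
  by rewrite !ler0_norm//; lra.
have lip Q q (br : branching D kap A Q q) u v :
    `|iter k (transfer D s Q) (fun x => x) u - iter k (transfer D s Q) (fun x => x) v|
    <= expR C1 * `|u - v|.
  have [dF _ bF _ _] := iter_transfer_id s kap1 A0 br k.
  apply: (derivf_lipschitz dF) => t; rewrite ger0_norm.
    by have /andP[] := bF t.
  by have /andP[+ _] := bF t; apply: le_trans; exact: expR_ge0.
rewrite /W !H_psi.
have -> : Phif (psif w y) - Phig (psig w (H y)) - (Phif (psif w z) - Phig (psig w (H z)))
  = (Phif (psif w y) - Phif (psif w z)) - (Phig (psig w (H y)) - Phig (psig w (H z))).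
  by ring.
have contr Q q (br : branching D kap A Q q) u v : I01 u -> I01 v ->
    `|branch s Q w u - branch s Q w v| <= kap ^+ m.
  move=> hu hv; apply: (le_trans (psi_contr s br w u v)).
  by rewrite sw ler_piMr// dist01.
apply: (le_trans (ler_normB _ _)); rewrite mulr_natl mulr2n; apply: lerD.
  apply: (le_trans (lip _ _ brf _ _)); rewrite ler_wpM2l ?expR_ge0//.
  exact: contr brf _ _ hy hz.
apply: (le_trans (lip _ _ brg _ _)); rewrite ler_wpM2l ?expR_ge0//.
by apply: contr brg _ _ _ _; exact: H01.
Qed.

End Comparison.

(** * The smooth approximation of the conjugacy *)

Lemma half_split N :
  [/\ (N./2 + (N - N./2))%N = N, (N./2 <= N - N./2)%N & (N <= (2 * N./2).+1)%N].
Proof. by split; lia. Qed.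

Section Approximation.
Variable R : realType.
Implicit Types (F f G g H : R -> R).

Lemma periodic_int (T : Type) (f : R -> T) : (forall x, f (x + 1) = f x) ->
  forall (n : int) x, f (x + n%:~R) = f x.
Proof.
move=> pf [n|n] x.
  by elim: n x => [|n IH] x; rewrite ?addr0// -[n.+1]addn1 PoszD intrD addrA pf IH.
rewrite NegzE; elim: n x => [|n IH] x.
  by rewrite -[in RHS](subrK 1 x) pf.
rewrite -(IH x) -[in RHS](subrK 1 (x + _)) pf; congr f.
by rewrite -[n.+2]addn1 PoszD opprD intrD addrA.
Qed.

Lemma translation_int (P : R -> R) : (forall x, P (x + 1) = P x + 1) ->
  forall (n : int) x, P (x + n%:~R) = P x + n%:~R.
Proof.
move=> pP n x; have ph z : P (z + 1) - (z + 1) = P z - z by rewrite pP; ring.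
by have h := periodic_int ph n x; rewrite -[LHS](subrK (x + n%:~R)) h; ring.
Qed.

Lemma periodic_I01 (T : Type) (f : R -> T) : (forall x, f (x + 1) = f x) ->
  forall x, exists2 y, I01 y & f x = f y.
Proof.
move=> pf x; exists (x - (Num.floor x)%:~R).
  have := floor_itv x; rewrite intrD => /andP[h1 h2].
  by rewrite /I01; lra.
by rewrite -{1}(subrK (Num.floor x)%:~R x) (periodic_int pf).
Qed.

(** [P] is [h_N] in lifted coordinates. The constant [B] must not depend on [N], since it later
    controls the regularity of the derivative of [f_N]. *)
Record core_solution (B K mu : R) (N : nat) H (P Pi p : R -> R) := CoreSolution {
  core_K : cancel P Pi;
  core_VK : cancel Pi P;
  core_smooth : smooth 2 P;
  core_smoothV : smooth 2 Pi;
  core_deriv : derivf P p;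
  core_per : forall x, P (x + 1) = P x + 1;
  core_close : forall x, `|P x - H x| <= K * mu ^+ N;
  core_bounds : forall x, B^-1 <= p x <= B;
  core_loglip : forall x y, loglip B p x y }.

Lemma conjugacy_approx (kap A : R) : 0 < kap < 1 -> 0 <= A ->
  exists B K mu, [/\ 1 <= B, 0 < K, 0 < mu < 1 &
  forall D s Qf qf Qg qg H N,
    branching D kap A Qf qf -> branching D kap A Qg qg ->
    smooth 2 Qf -> smooth 2 Qg ->
    {mono H : x y / x <= y} -> H 0 = 0 -> (forall x, H (x + 1) = H x + 1) ->
    (forall (i : 'I_D) x, H (branch1 s Qf i x) = branch1 s Qg i (H x)) ->
    (forall (w : seq 'I_D) p, size w = N -> I01 p -> branch s Qf w p = p ->
      `|dbranch s Qf qf w p| = `|dbranch s Qg qg w (H p)|) ->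
    exists P Pi p, core_solution B K mu N H P Pi p].
Proof.
move=> /andP[kap0 kap1] A0.
set C1 := A / (1 - kap); set C := C1 + 1.
pose shrink := expR (- C) * (1 - kap) / C.
have /andP[sh0 sh1] : 0 < shrink < 1 := shrink_bounds kap0 kap1 A0.
have C10 : 0 <= C1 by exact: C1_ge0.
(* [nu] is the slower of the distortion and mixing rates; each gets about [N / 2] steps, hence the
   square root. *)
pose nu := Num.max kap (1 - shrink); pose mu := Num.sqrt nu.
have nu0 : 0 < nu by rewrite lt_max kap0.
have nu1 : nu < 1 by rewrite gt_max kap1 gtrBl.
have mu0 : 0 < mu by rewrite sqrtr_gt0.
have mu1 : mu < 1 by rewrite -sqrtr1 ltr_sqrt.
(* The coefficient of [nu ^+ m] in [transfer_id_close] once both rates are replaced by [nu]. *)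
pose K0 := 2 * expR C + 8 * C1 * expR (4 * C1) * expR C + 2 * expR C1.
have K00 : 0 < K0.
  have h1 := expR_gt0 C; have h2 := expR_gt0 C1; have h3 := expR_gt0 (4 * C1).
  have h4 : 0 <= 8 * C1 * expR (4 * C1) * expR C.
    by rewrite mulr_ge0 ?(ltW h1)// mulr_ge0 ?(ltW h3)// mulr_ge0.
  rewrite /K0; lra.
(* [expR (2 * C1)] bounds a quotient of two densities lying between [expR (- C1)] and [expR C1]; the
   other terms are the logarithmic Lipschitz constant of that quotient, [gam] being read through
   [P]. *)
pose B := expR (2 * C1) + C1 + C1 * expR (2 * C1).
have eB : 1 <= expR (2 * C1) by rewrite -[leLHS]expR0 ler_expR mulr_ge0.
have eB' : expR (2 * C1) <= B.
  by rewrite /B -addrA lerDl addr_ge0// mulr_ge0// expR_ge0.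
have lB : C1 + C1 * expR (2 * C1) <= B by rewrite /B -addrA lerDr expR_ge0.
exists B, (expR C1 * K0 / mu), mu; split=> //.
- exact: le_trans eB eB'.
- by rewrite divr_gt0// mulr_gt0// expR_gt0.
- by rewrite mu0.
move=> D s Qf qf Qg qg H N brf brg sQf sQg mH H0 pH Hb matched.
pose m := N./2; pose k := (N - m)%N.
have [hmk hmk2 hN] := half_split N; rewrite -/m -/k in hmk hmk2 hN.
have H1 : H 1 = 1 by rewrite -[1]add0r pH H0.
rewrite -hmk in matched.
have close := transfer_id_close kap0 kap1 A0 brf brg mH H0 H1 Hb matched.
have [dF pF bF lF sF] := iter_transfer_id s kap1 A0 brf k.
have [dG pG bG lG sG] := iter_transfer_id s kap1 A0 brg k.
move: close dF pF bF lF sF dG pG bG lG sG; rewrite -/C1 -/C -/shrink.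
set Phi := iter k (transfer D s Qf) _; set phi := iter k (dtransfer D s Qf qf) _.
set Gam := iter k (transfer D s Qg) _; set gam := iter k (dtransfer D s Qg qg) _.
move=> close dF pF bF lF sF dG pG bG lG sG.
have e1 : 0 < expR (- C1) by exact: expR_gt0.
have [Fi [FK FiK dFi]] := derivf_inverse dF e1 (fun x => proj1 (andP (bF x))).
have [Gi [GK GiK dGi]] := derivf_inverse dG e1 (fun x => proj1 (andP (bG x))).
have phi0 x : 0 < phi x by have /andP[h _] := bF x; exact: lt_le_trans e1 h.
have gam0 x : 0 < gam x by have /andP[h _] := bG x; exact: lt_le_trans e1 h.
have sFi : smooth 2 Fi.
  by apply: (smooth_inverse (sF 2%N sQf) dF) dFi => x; rewrite gt_eqF.
have sGi : smooth 2 Gi.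
  by apply: (smooth_inverse (sG 2%N sQg) dG) dGi => x; rewrite gt_eqF.
(* Monotone transport of one push-forward to the other. The additive constants make [P 0 = 0], as
   [Phi] and [Gam] need not vanish at 0. *)
pose P x := Gi (Phi x - Phi 0 + Gam 0); pose Pi y := Fi (Gam y - Gam 0 + Phi 0).
have GP x : Gam (P x) = Phi x - Phi 0 + Gam 0 by rewrite /P GiK.
have dP : derivf P (fun x => (gam (P x))^-1 * phi x).
  apply: (derivf_ext (derivf_comp dGi (derivfD (derivfB dF (derivf_cst _))
    (derivf_cst (Gam 0))))) => // x.
  by rewrite subr0 addr0.
have pb x : (expR (2 * C1))^-1 <= (gam (P x))^-1 * phi x <= expR (2 * C1).
  have /andP[f1 f2] := bF x; have /andP[g1 g2] := bG (P x).
  rewrite -expRN [_^-1 * _]mulrC ler_pdivlMr// ler_pdivrMr//; apply/andP; split.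
    apply: le_trans f1; apply: (@le_trans _ _ (expR (- (2 * C1)) * expR C1)).
      by rewrite ler_wpM2l// expR_ge0.
    by rewrite -expRD ler_expR; lra.
  apply: (le_trans f2); apply: (@le_trans _ _ (expR (2 * C1) * expR (- C1))).
    by rewrite -expRD ler_expR; lra.
  by rewrite ler_wpM2l// expR_ge0.
have pP x : P (x + 1) = P x + 1.
  apply: (can_inj GK); rewrite pG !GP pF; ring.
have sumsmooth n U (a b : R) : smooth n U -> smooth n (fun x => U x - a + b).
  move=> sU; apply: smoothD; last exact: smooth_cst.
  by apply: smoothD => //; exact: smooth_cst.
exists P, Pi, (fun x => (gam (P x))^-1 * phi x); split=> //.
- by move=> x; rewrite /Pi GP addrK subrK FK.
- by move=> y; rewrite /P /Pi FiK addrK subrK GK.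
- by apply: (@smooth_comp _ _ Gi) => //; apply: sumsmooth; exact: sF.
- by apply: (@smooth_comp _ _ Fi) => //; apply: sumsmooth; exact: sG.
- move=> x.
  have [|y hy ->] := @periodic_I01 R (fun x => `|P x - H x|) _ x.
    by move=> z; rewrite pP pH; congr (`|_|); ring.
  (* As [Gam (P y)] is [Phi y] up to constants, [close] bounds [Gam (P y) - Gam (H y)]; dividing by
     a value of [gam] costs the factor [expR C1]. *)
  have [c [_ _ _ e]] := mvt (H y) (P y) dG.
  have := close y hy.
  have -> : Phi y - Phi 0 - (Gam (H y) - Gam 0) = gam c * (P y - H y).
    by rewrite -e GP; ring.
  rewrite normrM gtr0_norm// => h.
  have /andP[g1 _] := bG c.
  have {h} := le_trans (ler_wpM2r (normr_ge0 (P y - H y)) g1) h.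
  rewrite -(ler_pM2l (expR_gt0 C1)) mulrA -expRD subrr expR0 mul1r => /le_trans; apply.
  rewrite -(mulrA (expR C1 * K0)) -(mulrA (expR C1)).
  apply: ler_wpM2l; first exact: expR_ge0.
  (* Here [nu ^+ m = mu ^+ (2 * m)] while [N] may be [2 * m + 1]; the odd case costs the factor
     [mu^-1]. *)
  have num : nu ^+ m <= mu^-1 * mu ^+ N.
    have -> : nu = mu ^+ 2 by rewrite sqr_sqrtr// ltW.
    rewrite -exprM mulrC ler_pdivlMr// -exprSr.
    by apply: ler_wiXn2l; rewrite ?ltW.
  apply: (@le_trans _ _ (K0 * nu ^+ m)); last by rewrite ler_wpM2l// ltW.
  have kn : kap ^+ m <= nu ^+ m by rewrite lerXn2r ?nnegrE ?(ltW kap0) ?(ltW nu0)// le_max lexx.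
  have sn : (1 - shrink) ^+ k <= nu ^+ m.
    apply: (@le_trans _ _ ((1 - shrink) ^+ m)).
      by apply: ler_wiXn2l => //; lra.
    by rewrite lerXn2r ?nnegrE ?subr_ge0 ?(ltW sh1) ?(ltW nu0)// le_max lexx orbT.
  have t1 := ler_wpM2r (expR_ge0 C) sn.
  have t2 : 4 * C1 * kap ^+ m * expR (4 * C1) * expR C <=
      4 * C1 * nu ^+ m * expR (4 * C1) * expR C.
    by rewrite !ler_wpM2r ?expR_ge0// ler_wpM2l// mulr_ge0.
  have t3 := ler_wpM2l (expR_ge0 C1) kn.
  rewrite /K0; lra.
- move=> x; have /andP[h1 h2] := pb x; rewrite (le_trans h2)// andbT.
  by apply: le_trans h1; rewrite lef_pV2 ?posrE ?expR_gt0// (lt_le_trans _ eB')// expR_gt0.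
- move=> x y; apply: loglip_le lB _ _.
    by rewrite mulr_ge0 ?invr_ge0 ?ltW.
  rewrite addrC; apply: loglipM; rewrite ?invr_ge0 ?(ltW (gam0 _)) ?(ltW (phi0 _))//.
  apply: (@loglip_comp R C1 (expR (2 * C1)) (fun z => (gam z)^-1) P) => //.
  - by rewrite invr_ge0 ltW.
  - apply: (derivf_lipschitz dP) => z; rewrite ger0_norm; first by case/andP: (pb z).
    by rewrite mulr_ge0 ?invr_ge0 ?ltW.
  - exact: loglipV.
Qed.

End Approximation.

(** * Lifts *)
Section Lifts.
Variable R : realType.
Implicit Types (F f G g H Q q : R -> R).

Definition eqZ (x y : R) := exists n : int, x = y + n%:~R.

Lemma eqZ_refl x : eqZ x x.
Proof. by exists 0; rewrite addr0. Qed.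

Lemma eqZ_sym x y : eqZ x y -> eqZ y x.
Proof. by move=> [n ->]; exists (- n); rewrite rmorphN/= addrK. Qed.

Lemma eqZ_trans x y z : eqZ x y -> eqZ y z -> eqZ x z.
Proof. by move=> [n ->] [p ->]; exists (p + n); rewrite rmorphD/= addrA. Qed.

Fixpoint iter_deriv n F f x := if n is m.+1 then f x * iter_deriv m F f (F x) else 1.

(** A lift in a coordinate centred at a fixed point, of degree [sg R s * D]. One constant [M] bounds
    the derivative and its Lipschitz constant. *)
Record lift (gamma M : R) (s : bool) (D : nat) F f := Lift {
  lift_deriv : derivf F f;
  lift_smooth : smooth 2 F;
  lift_zero : F 0 = 0;
  lift_per : forall x, F (x + 1) = F x + sg R s * D%:R;
  lift_ge : forall x, gamma <= sg R s * f x;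
  lift_le : forall x, `|f x| <= M;
  lift_lip : forall x y, `|f x - f y| <= M * `|x - y| }.

Section OneLift.
Variables (gamma M : R) (s : bool) (D : nat) (F f : R -> R).
Hypotheses (gamma1 : 1 < gamma) (M0 : 0 <= M) (FL : lift gamma M s D F f).

Lemma lift_deriv_per x : f (x + 1) = f x.
Proof.
have d1 := derivf_comp (lift_deriv FL) (derivfD (@derivf_id R) (derivf_cst 1)).
have d2 := derivfD (lift_deriv FL) (derivf_cst (sg R s * D%:R)).
have d3 := derivf_ext d1 (lift_per FL) (fun x => erefl _).
by have := derivf_unique d3 d2 x; rewrite !addr0 mulr1.
Qed.

Lemma sgD_int : sg R s * D%:R = (((-1) ^+ s * D%:Z) : int)%:~R.
Proof. by rewrite rmorphM /= rmorphXn /= rmorphN. Qed.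

Lemma lift_eqZ x y : eqZ x y -> eqZ (F x) (F y).
Proof.
move=> [n ->]; exists (n * ((-1) ^+ s * D%:Z)).
pose h z := F z - z * (sg R s * D%:R).
have ph z : h (z + 1) = h z by rewrite /h (lift_per FL); ring.
have := periodic_int ph n y; rewrite /h rmorphM/= -sgD_int => e.
by rewrite -[F (y + _)](subrK ((y + n%:~R) * (sg R s * D%:R))) e; ring.
Qed.

Lemma iter_lift_eqZ n x y : eqZ x y -> eqZ (iter n F x) (iter n F y).
Proof. by move=> xy; elim: n => //= n; exact: lift_eqZ. Qed.

Lemma iter_deriv_eqZ n x y : eqZ x y -> iter_deriv n F f x = iter_deriv n F f y.
Proof.
elim: n x y => //= n IH x y xy; congr (_ * _); last by apply: IH; exact: lift_eqZ.
by case: xy => k ->; exact: (periodic_int lift_deriv_per).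
Qed.

Lemma lift_gt0 x : 0 < sg R s * f x.
Proof. by apply: lt_le_trans (lift_ge FL x); apply: lt_trans gamma1. Qed.

Lemma lift_normE x : `|f x| = sg R s * f x.
Proof. by rewrite -[RHS]gtr0_norm ?lift_gt0// normrM norm_sg mul1r. Qed.

(** The signed derivative is at least 1, so an additive variation is also a relative one, and
    [1 + z <= expR z]. *)
Lemma loglip_lift x y : loglip M (fun z => sg R s * f z) x y.
Proof.
have h1 : sg R s * f x - sg R s * f y <= M * `|x - y|.
  apply: le_trans (lift_lip FL x y).
  by rewrite -mulrBr (le_trans (ler_norm _))// normrM norm_sg mul1r.
have fy : 1 <= sg R s * f y by apply: le_trans (lift_ge FL y); exact: ltW.
have h2 : 1 + M * `|x - y| <= expR (M * `|x - y|) by exact: expR_ge1Dx.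
have t0 : 0 <= M * `|x - y| by rewrite mulr_ge0.
have h3 := ler_wpM2l t0 fy.
have fy0 : 0 <= sg R s * f y by exact: le_trans fy.
have h4 := ler_wpM2r fy0 h2.
by rewrite /loglip; lra.
Qed.

Lemma lift_branching : exists Q, [/\ cancel (fun x => sg R s * F x) Q,
   cancel Q (fun x => sg R s * F x), smooth 2 Q &
   branching D gamma^-1 M Q (fun y => (sg R s * f (Q y))^-1)].
Proof.
have g0 : 0 < gamma by apply: lt_trans gamma1.
have dF := derivfZ (sg R s) (lift_deriv FL).
have [Q [FK QK dQ]] := derivf_inverse dF g0 (lift_ge FL).
have qb y : 0 < (sg R s * f (Q y))^-1 <= gamma^-1.
  by rewrite invr_gt0 lift_gt0 lef_pV2 ?posrE ?lift_gt0 ?(lift_ge FL).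
exists Q; split=> //.
  apply: (smooth_inverse _ dF _ dQ); last by move=> x; rewrite gt_eqF ?lift_gt0.
  by apply: smoothM (smooth_cst _ _) (lift_smooth FL).
split=> // [|y|y|y|x y].
- by have := FK 0; rewrite (lift_zero FL) mulr0.
- apply: (can_inj FK); rewrite QK (lift_per FL) mulrDr mulrA sgM mul1r.
  by congr (_ + _); rewrite QK.
- by case/andP: (qb y).
- by case/andP: (qb y).
- have h := loglip_comp (k := gamma^-1) (g := Q) (u := fun z => (sg R s * f z)^-1) (x := x) (y := y) M0.
  apply: (loglip_le (C := M * gamma^-1)).
  + by rewrite ler_piMr// invf_le1// ltW.
  + by have /andP[/ltW] := qb y.
  + apply: h => //; first by have /andP[/ltW] := qb y.
      apply: (derivf_lipschitz dQ) => z; rewrite ger0_norm; first by case/andP: (qb z).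
      by have /andP[/ltW] := qb z.
    apply: loglipV; [exact: lift_gt0|exact: lift_gt0|exact: loglip_lift].
Qed.

Variable Q : R -> R.
Hypothesis QK : cancel Q (fun x => sg R s * F x).

(** The integer separating [F] of a branch from the identity: in the flipped case [F] gives
    [- (i + (1 - x)) = x - (i + 1)]. *)
Definition branch_shift (i : nat) : int := if s then - (i%:Z + 1) else i%:Z.

Lemma lift_branch1 (i : 'I_D) x :
  F (branch1 s Q i x) = x + (branch_shift i)%:~R.
Proof.
have -> y : F y = sg R s * (sg R s * F y) by rewrite mulrA sgM mul1r.
rewrite /branch1 QK /sg /fold /branch_shift; case: s => /=; last first.
  by rewrite mul1r addrC.
by rewrite expr1 rmorphN/= rmorphD/=; ring.
Qed.

Lemma iter_lift_branch (w : seq 'I_D) x : eqZ (iter (size w) F (branch s Q w x)) x.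
Proof.
elim: w => [|i w IH]; first exact: eqZ_refl.
rewrite iterSr /= lift_branch1; apply: eqZ_trans IH.
by apply: iter_lift_eqZ; exists (branch_shift i).
Qed.

(** The chain rule for an inverse; integer shifts along the orbit disappear because the derivative
    of the lift is periodic. *)
Lemma iter_deriv_branch (w : seq 'I_D) x :
  iter_deriv (size w) F f (branch s Q w x) *
  dbranch s Q (fun y => (sg R s * f (Q y))^-1) w x = 1.
Proof.
elim: w => [|i w IH] /=; first by rewrite mulr1.
rewrite lift_branch1 (@iter_deriv_eqZ _ _ (branch s Q w x)); last first.
  by exists (branch_shift i).
rewrite mulrACA IH mulr1 /branch1 /dbranch1.
set z := Q _; have := lift_gt0 z; rewrite mulrA [f z * _]mulrC => z0.
by rewrite mulfV// gt_eqF.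
Qed.

End OneLift.
Lemma derivf_cancel (P p Pi pi : R -> R) : derivf P p -> derivf Pi pi ->
  cancel Pi P -> (forall y, p (Pi y) != 0) -> pi =1 fun y => (p (Pi y))^-1.
Proof.
move=> dP dPi PiK p0 y.
have d1 := derivf_ext (derivf_comp dP dPi) PiK (fun x => erefl _).
have e := derivf_unique d1 (@derivf_id R) y.
by rewrite -[LHS](mulKf (p0 y)) e mulr1.
Qed.

Lemma lift_approx (gamma M : R) : 1 < gamma -> 1 <= M ->
  exists K K1 lam, [/\ 0 < K, 0 < K1, 0 < lam < 1 &
  forall D s F f G g H N,
    lift gamma M s D F f -> lift gamma M s D G g ->
    {mono H : x y / x <= y} -> H 0 = 0 -> (forall x, H (x + 1) = H x + 1) ->
    (forall x, H (F x) = G (H x)) ->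
    (forall p, eqZ (iter N F p) p -> iter_deriv N F f p = iter_deriv N G g (H p)) ->
    exists P Pi fn,
      [/\ cancel P Pi, cancel Pi P, smooth 2 P, smooth 2 Pi &
          forall x, P (x + 1) = P x + 1] /\
      [/\ forall x, `|P x - H x| <= K * lam ^+ N,
          derivf (fun x => Pi (G (P x))) fn,
          forall x, `|F x - Pi (G (P x))| <= K1 * Num.sqrt lam ^+ N &
          forall x, `|f x - fn x| <= K1 * Num.sqrt lam ^+ N]].
Proof.
move=> gamma1 M1; have M0 : 0 <= M by exact: le_trans M1.
have g0 : 0 < gamma by apply: lt_trans gamma1.
have kap01 : 0 < gamma^-1 < 1 by rewrite invr_gt0 g0 invf_lt1.
have [B [K [mu [B1 K0 mu01 core]]]] := conjugacy_approx kap01 M0.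
have /andP[mu0 mu1] := mu01.
have B0 : 0 <= B by exact: le_trans B1.
(* [c] bounds the [C^0] error: [K] is incurred once at [F x] and once at [x] through [G], and [B] is
   the cost of undoing [P]. *)
pose c := B * ((1 + M) * K).
have c0 : 0 < c by rewrite !mulr_gt0 ?(lt_le_trans _ B1)// ltr_wpDr.
(* [M2] bounds the derivative of [Pi (G (P x))], a product of three factors, and [C2] adds their
   logarithmic Lipschitz constants. [B'] is the resulting Lipschitz constant of [f - fn] at
   distances up to 1. *)
pose M2 := B * M * B; pose C2 := B * M2 + M * B + B.
pose B' := M + M2 * C2 * expR C2.
have M20 : 0 <= M2 by rewrite !mulr_ge0.
have C20 : 0 <= C2 by rewrite /C2 !addr_ge0// mulr_ge0.
have B'0 : 0 <= B' by rewrite addr_ge0// !mulr_ge0// expR_ge0.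
exists K, (2 * c + B'), mu; split=> //.
  by rewrite ltr_wpDr// mulr_gt0.
move=> D s F f G g H N FL GL mH H0 pH conj matched.
have [Qf [FK QfK sQf brf]] := lift_branching gamma1 M0 FL.
have [Qg [GK QgK sQg brg]] := lift_branching gamma1 M0 GL.
have Hb (i : 'I_D) x : H (branch1 s Qf i x) = branch1 s Qg i (H x).
  have inj : injective G.
    by move=> a b e; apply: (can_inj GK); rewrite e.
  by apply: inj; rewrite -conj (lift_branch1 QfK) (lift_branch1 QgK) (translation_int pH).
have matchw (w : seq 'I_D) p : size w = N -> I01 p -> branch s Qf w p = p ->
    `|dbranch s Qf (fun y => (sg R s * f (Qf y))^-1) w p| =
    `|dbranch s Qg (fun y => (sg R s * g (Qg y))^-1) w (H p)|.
  move=> sw hp ep; congr (`|_|).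
  have eH : branch s Qg w (H p) = H p.
    by rewrite -[in RHS]ep; elim: {sw ep} w => //= i w IH; rewrite Hb IH.
  have ef := iter_deriv_branch gamma1 FL QfK w p.
  have eg := iter_deriv_branch gamma1 GL QgK w (H p).
  rewrite ep sw in ef; rewrite eH sw in eg.
  have hm : iter_deriv N F f p = iter_deriv N G g (H p).
    by apply: matched; have := iter_lift_branch FL QfK w p; rewrite ep sw.
  have n0 : iter_deriv N F f p != 0.
    by apply: contra_eq_neq ef => ->; rewrite mul0r eq_sym oner_neq0.
  by apply: (mulfI n0); rewrite ef hm eg.
have [P [Pi [p cs]]] := core _ _ _ _ _ _ _ _ brf brg sQf sQg mH H0 pH Hb matchw.
have p0 x : 0 < p x.
  have /andP[+ _] := core_bounds cs x; apply: lt_le_trans.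
  by rewrite invr_gt0 (lt_le_trans _ B1).
have pB x : p x <= B by case/andP: (core_bounds cs x).
have pV x : (p x)^-1 <= B.
  rewrite -[B]invrK lef_pV2 ?posrE//; last by rewrite invr_gt0 (lt_le_trans _ B1).
  by case/andP: (core_bounds cs x).
have dPi : derivf Pi (fun y => (p (Pi y))^-1).
  have [pi dpi _] := core_smoothV cs.
  apply: (derivf_ext dpi) => //; apply: (derivf_cancel (core_deriv cs) dpi (core_VK cs)).
  by move=> y; rewrite gt_eqF.
pose Fn x := Pi (G (P x)); pose fn x := (p (Fn x))^-1 * (g (P x) * p x).
have dFn : derivf Fn fn by exact: derivf_comp dPi (derivf_comp (lift_deriv GL) (core_deriv cs)).
(* The orientation sign is removed so that all factors are positive and [loglip] applies to the
   product. *)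
pose u x := (p (Fn x))^-1 * (sg R s * g (P x)) * p x.
have fnE x : fn x = sg R s * u x.
  by rewrite /fn /u -[LHS]mul1r -(sgM R s); ring.
have gpos x : 0 < sg R s * g x by exact: lift_gt0 gamma1 GL x.
have gM x : sg R s * g x <= M by rewrite -(lift_normE gamma1 GL) (lift_le GL).
have uM x : 0 <= u x <= M2.
  have pV0 : 0 <= (p (Fn x))^-1 by rewrite invr_ge0 ltW.
  have g0' := ltW (gpos (P x)); have p0' := ltW (p0 x).
  apply/andP; split; first by apply: mulr_ge0 => //; exact: mulr_ge0.
  by apply: ler_pM => //; [exact: mulr_ge0|exact: ler_pM].
have PL x y : `|P x - P y| <= B * `|x - y|.
  by apply: (derivf_lipschitz (core_deriv cs)) => z; rewrite gtr0_norm.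
have FnL x y : `|Fn x - Fn y| <= M2 * `|x - y|.
  apply: (derivf_lipschitz dFn) => z; rewrite fnE normrM norm_sg mul1r.
  by have /andP[? ?] := uM z; rewrite ger0_norm.
have ul x y : loglip C2 u x y.
  have pV0 z : 0 <= (p (Fn z))^-1 by rewrite invr_ge0 ltW.
  have g0' z := ltW (gpos (P z)); have p0' z := ltW (p0 z).
  apply: (@loglipM R _ _ (fun z => (p (Fn z))^-1 * (sg R s * g (P z))) p) => //.
  - exact: mulr_ge0.
  - apply: (@loglipM R _ _ (fun z => (p (Fn z))^-1) (fun z => sg R s * g (P z))) => //.
    apply: (@loglip_comp R B M2 (fun z => (p z)^-1) Fn) => //.
      by apply: loglipV => //; exact: core_loglip cs _ _.
    apply: (@loglip_comp R M B (fun z => sg R s * g z) P) => //.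
    exact: loglip_lift gamma1 M0 GL _ _.
  - exact: core_loglip cs x y.
have uL := loglip_lipschitz C20 uM ul.
have FFn x : `|F x - Fn x| <= c * mu ^+ N.
  have [z [_ _ _ e]] := mvt (Fn x) (F x) (core_deriv cs).
  have h1 : `|F x - Fn x| <= B * `|P (F x) - P (Fn x)|.
    rewrite e normrM gtr0_norm// mulrA; rewrite -{1}[`|_|]mul1r ler_wpM2r//.
    by rewrite mulrC -ler_pdivrMl// mulr1.
  apply: (le_trans h1); rewrite /c -mulrA ler_wpM2l//.
  rewrite /Fn (core_VK cs).
  (* The difference would vanish with [H] in place of [P], by the conjugacy. *)
  have -> : P (F x) - G (P x) = (P (F x) - H (F x)) - (G (P x) - G (H x)).
    by rewrite conj; ring.
  apply: (le_trans (ler_normB _ _)).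
  have h2 := core_close cs (F x).
  have h3 : `|G (P x) - G (H x)| <= M * (K * mu ^+ N).
    apply: (le_trans (derivf_lipschitz (lift_deriv GL) (lift_le GL) _ _)).
    by rewrite ler_wpM2l// (core_close cs).
  lra.
have s0 : 0 < Num.sqrt mu by rewrite sqrtr_gt0.
have sN : 0 < Num.sqrt mu ^+ N <= 1.
  by rewrite exprn_gt0//= exprn_ile1 ?ltW// -sqrtr1 ltr_sqrt.
have sE : mu ^+ N = Num.sqrt mu ^+ N * Num.sqrt mu ^+ N.
  by rewrite -exprMn -expr2 sqr_sqrtr// ltW.
have /andP[sN0 sN1] := sN.
exists P, Pi, fn; split; first by case: cs => *; split.
split=> //; first exact: core_close cs.
- move=> x; apply: (le_trans (FFn x)); rewrite sE mulrA ler_wpM2r ?(ltW sN0)//.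
  apply: (@le_trans _ _ c); first by rewrite ler_piMr// ltW.
  lra.
(* Interpolation at the scale [s = Num.sqrt mu ^+ N], for which [s * s = mu ^+ N]. *)
- apply: (@landau R (fun x => F x - Fn x)) => //.
  + exact: derivfB (lift_deriv FL) dFn.
  + move=> x y xy.
    have -> : f x - fn x - (f y - fn y) = (f x - f y) - sg R s * (u x - u y).
      by rewrite !fnE; ring.
    apply: (le_trans (ler_normB _ _)); rewrite normrM norm_sg mul1r mulrDl.
    by rewrite lerD ?uL// (lift_lip FL).
  + by move=> x; rewrite -sE.
Qed.

End Lifts.

(** * The circle *)
Section Circle.
Variable R : realType.
Local Notation S1 := (circle R).
Implicit Types (x y z : R) (F G : R -> R) (f g h : S1 -> S1) (p q : S1).

Lemma toS1_eq x y : toS1 x = toS1 y <-> eqZ x y.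
Proof.
have E := @Quotient.idealrBE R (GRing.ZmodClosed.clone R (@Num.int_num_subdef R) _) x y.
split=> [xy|[n ->]].
  have : x - y \is a Num.int by rewrite E; apply/eqP.
  by move=> /intrP[n e]; exists n; rewrite -e addrC subrK.
have {}E := @Quotient.idealrBE R
  (GRing.ZmodClosed.clone R (@Num.int_num_subdef R) _) (y + n%:~R) y.
have : y + n%:~R - y \is a Num.int by rewrite addrC addKr; apply/intrP; exists n.
by rewrite E => /eqP.
Qed.

Lemma toS1_repr p : toS1 (repr p) = p.
Proof. exact: reprK. Qed.

Lemma toS1_continuous : continuous (@toS1 R).
Proof. exact: pi_continuous. Qed.

Lemma cdist_le x y : cdist (toS1 x) (toS1 y) <= `|x - y|.
Proof.
apply: ge_inf; last by exists x, y.
by exists 0 => _ [a [b [_ _ ->]]]; exact: normr_ge0.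
Qed.

(** If two values differed, they would be at least 1 apart, and the intermediate value theorem would
    produce the smaller one plus one half. *)
Lemma eqZ_valued_const F : continuous F -> (forall x, eqZ (F x) 0) ->
  forall x, F x = F 0.
Proof.
move=> cF FZ.
have dist1 (a b : R) : eqZ a 0 -> eqZ b 0 -> a < b -> a + 1 <= b.
  move=> [n ->] [m ->]; rewrite !add0r ltr_int => nm.
  by rewrite -(intrD _ n 1) ler_int lezD1.
have noinc x y : x <= y -> F x = F y.
  move=> xy; apply/eqP; apply: contraT => ne.
  pose v := Num.min (F x) (F y) + 2^-1.
  have sep : Num.min (F x) (F y) + 1 <= Num.max (F x) (F y).
    by case: (ltgtP (F x) (F y)) ne => // lt _; exact: dist1.
  have [||c _ e] := @IVT _ F x y v xy.
  - by apply: continuous_subspaceT => z; exact: cF.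
  - by rewrite /v; lra.
  have mZ : eqZ (Num.min (F x) (F y)) 0 by case: (leP (F x) (F y)) => _; exact: FZ.
  have h1 : Num.min (F x) (F y) < F c by rewrite e /v; lra.
  have := dist1 _ _ mZ (FZ c) h1; rewrite e /v; lra.
by move=> x; have [/noinc|/ltW/noinc] := leP x 0.
Qed.

Lemma lift_unique f F G : is_lift f F -> is_lift f G -> forall x, F x = G x + (F 0 - G 0).
Proof.
move=> [cF lF] [cG lG] x.
have cD : continuous (fun x => F x - G x).
  by move=> z; exact: (cvgB (cF z) (cG z)).
have FG z : eqZ (F z - G z) 0.
  have [n ->] : eqZ (F z) (G z) by apply/toS1_eq; rewrite lF lG.
  by exists n; rewrite add0r addrC addKr.
have := eqZ_valued_const cD FG x => /= <-; ring.
Qed.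

Lemma lift_degree f F : is_lift f F -> exists d : int, forall x, F (x + 1) = F x + d%:~R.
Proof.
move=> [cF lF].
have cD : continuous (fun x => F (x + 1) - F x).
  move=> z; apply: (cvgB _ (cF z)).
  apply: (@continuous_comp _ _ _ (fun x => x + 1) F z); last exact: cF.
  exact: (cvgD cvg_id (cvg_cst _)).
have FZ z : eqZ (F (z + 1) - F z) 0.
  have [n ->] : eqZ (F (z + 1)) (F z).
    apply/toS1_eq; rewrite !lF; congr f; apply/toS1_eq; by exists 1.
  by exists n; rewrite add0r addrC addKr.
have [d e] := FZ 0; exists d => x.
by have := eqZ_valued_const cD FZ x; rewrite /= e add0r => <-; ring.
Qed.

Lemma lift_ofP f F : is_lift f F -> is_lift f (lift_of f).
Proof. by move=> lF; apply: (@getPex _ [set F | is_lift f F]); exists F. Qed.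

(** Frees [derivc] from its arbitrary lift and representative: lifts differ by a constant and the
    derivative is 1-periodic. *)
Lemma derivc_lift f F F1 : is_lift f F -> derivf F F1 ->
  forall x, derivc 1 f (toS1 x) = F1 x.
Proof.
move=> lF dF x; have lL := lift_ofP lF.
have dL : derivf (lift_of f) F1.
  apply: (derivf_ext (derivfD dF (derivf_cst (lift_of f 0 - F 0)))) => z.
    by rewrite (lift_unique lL lF z).
  by rewrite addr0.
rewrite /derivc derive1n1 (derivf_derive1 dL).
have [d dE] := lift_degree lF.
have per z : F1 (z + 1) = F1 z.
  have d1 := derivf_comp dF (derivfD (@derivf_id R) (derivf_cst 1)).
  have d2 := derivfD dF (derivf_cst d%:~R).
  have := derivf_unique (derivf_ext d1 dE (fun x => erefl _)) d2 z.
  by rewrite !addr0 mulr1.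
have [n ->] : eqZ (repr (toS1 x)) x by apply/toS1_eq; rewrite toS1_repr.
exact: periodic_int.
Qed.

Lemma derivc2_lift f F F1 F2 : is_lift f F -> derivf F F1 -> derivf F1 F2 ->
  forall x, derivc 2 f (toS1 x) = F2 x.
Proof.
move=> lF dF dF1 x; have lL := lift_ofP lF.
have dL : derivf (lift_of f) F1.
  apply: (derivf_ext (derivfD dF (derivf_cst (lift_of f 0 - F 0)))) => z.
    by rewrite (lift_unique lL lF z).
  by rewrite addr0.
rewrite /derivc derive1nS derive1n1 (derivf_derive1 dL) (derivf_derive1 dF1).
have per1 z : F1 (z + 1) = F1 z.
  rewrite -!(derivc_lift lF dF); congr (derivc 1 f _); apply/toS1_eq; by exists 1.
have per z : F2 (z + 1) = F2 z.
  have d1 := derivf_comp dF1 (derivfD (@derivf_id R) (derivf_cst 1)).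
  have := derivf_unique (derivf_ext d1 per1 (fun x => erefl _)) dF1 z.
  by rewrite !addr0 mulr1.
have [n ->] : eqZ (repr (toS1 x)) x by apply/toS1_eq; rewrite toS1_repr.
exact: periodic_int.
Qed.

Lemma derivf_derivable F : (forall x, derivable F x 1) -> derivf F (derive1 F).
Proof. by move=> dF x; rewrite derive1E; exact/derivableP. Qed.

Lemma CkR_smooth k F : CkR k F -> smooth k F.
Proof.
elim: k F => [|k IH] F [dF cF]; first exact: (cF 0%N).
exists (derive1 F); first by apply: derivf_derivable => x; exact: (dF 0%N).
apply: IH; split=> i ik; rewrite -derive1Sn; [exact: dF|exact: cF].
Qed.

Lemma smooth_CkR k F : smooth k F -> CkR k F.
Proof.
elim: k F => [|k IH] F; first by move=> cF; split=> // -[|i].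
move=> [F1 dF /IH[d1 c1]].
split=> -[|i] ik.
- by move=> x; have [] := dF x.
- by rewrite derive1Sn (derivf_derive1 dF); exact: d1.
- exact: derivf_continuous dF.
- by rewrite derive1Sn (derivf_derive1 dF); exact: c1.
Qed.

Lemma periodic_bounded F : continuous F -> (forall x, F (x + 1) = F x) ->
  exists2 M, 0 <= M & forall x, `|F x| <= M.
Proof.
move=> cF pF; have cN : continuous (fun x => `|F x|).
  by move=> x; apply: (@continuous_comp _ _ _ F Num.norm x (cF x)); exact: norm_continuous.
have [|c _ hc] := @EVT_max R (fun x => `|F x|) 0 1 ler01.
  by apply: continuous_subspaceT => z; exact: cN.
exists `|F c| => // x.
have [|y hy ->] := @periodic_I01 R R (fun x => `|F x|) _ x; first by move=> z; rewrite pF.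
by apply: hc; rewrite in_itv.
Qed.

End Circle.

(** * Lift of the conjugacy *)
Section Conjugacy.
Variable R : realType.
Local Notation S1 := (circle R).
Implicit Types (x y z : R) (F G H : R -> R) (f g h : S1 -> S1) (p q : S1).

Lemma toS1_open (a b : R) : open [set p : S1 | exists2 z, a < z < b & toS1 z = p].
Proof.
rewrite /open/= /quotient_open.
have -> : \pi_(S1)%qT @^-1` [set p : S1 | exists2 z, a < z < b & toS1 z = p] =
    \bigcup_(n : int) [set z : R | a < z + n%:~R < b].
  apply/seteqP; split=> z /=.
    by move=> [y hy /toS1_eq [n yz]]; exists n => //=; rewrite -yz.
  by move=> [n _ /= hz]; exists (z + n%:~R) => //; apply/toS1_eq; exists n.
apply: bigcup_open => n _.
have -> : [set z : R | a < z + n%:~R < b] = `]a - n%:~R, b - n%:~R[%classic.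
  by apply/seteqP; split=> z /=; rewrite in_itv/= ltrBlDr ltrBrDr.
exact: interval_open.
Qed.

Definition fracR x : R := x - (Num.floor x)%:~R.

Lemma fracR_itv x : 0 <= fracR x < 1.
Proof.
by have := floor_itv x; rewrite /fracR intrD => /andP[h1 h2]; apply/andP; split; lra.
Qed.

Lemma eqZ_fracR x : eqZ x (fracR x).
Proof. by exists (Num.floor x); rewrite /fracR subrK. Qed.

Lemma int_lt1 (n : int) : `|n%:~R : R| < 1 -> n = 0.
Proof.
rewrite -intr_norm -[1]/(1%:~R) ltr_int; lia.
Qed.

Lemma eqZ_eq x y : eqZ x y -> `|x - y| < 1 -> x = y.
Proof.
by move=> [n ->]; rewrite [y + _]addrC addrK => /int_lt1 ->; rewrite mulr0z add0r.
Qed.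

Lemma floorD_int x (n : int) : Num.floor (x + n%:~R) = Num.floor x + n.
Proof. by rewrite floorDrz ?intr_int// intrKfloor. Qed.

Lemma mono_surj_continuous H : {mono H : x y / x <= y} ->
  (forall y, exists x, H x = y) -> continuous H.
Proof.
move=> mH sH x; apply/cvgrPdist_lt => eps e0.
have [u hu] := sH (H x - eps); have [v hv] := sH (H x + eps).
have ux : u < x by rewrite -(leW_mono mH) hu; lra.
have xv : x < v by rewrite -(leW_mono mH) hv; lra.
near=> z.
have uz : u < z by near: z; exact: lt_nbhsr.
have zv : z < v by near: z; exact: lt_nbhsl.
have h1 : H u < H z by rewrite (leW_mono mH).
have h2 : H z < H v by rewrite (leW_mono mH).
by rewrite ltr_norml; lra.
Unshelve. all: by end_near. Qed.

(* On ]0, 1[ the coordinate of [h] has no wrap-around, so it is a continuous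
   injective function; its monotonicity decides the orientation [e], and gluing
   the translates of the monotone branch gives the lift without any path lifting. *)
Lemma homeo_lift h x0 y0 : homeomorphism h -> h (toS1 x0) = toS1 y0 ->
  exists (e : R) H, [/\ e = 1 \/ e = -1, {mono H : x y / x <= y}, continuous H,
    H 0 = 0 & forall x, H (x + 1) = H x + 1] /\
    forall x, toS1 (y0 + H x) = h (toS1 (x0 + e * x)).
Proof.
move=> [ch [h' [hK h'K _]]] hx0.
pose phi x := fracR (repr (h (toS1 (x0 + x))) - y0).
have phiE x : toS1 (y0 + phi x) = h (toS1 (x0 + x)).
  rewrite -[RHS]toS1_repr; apply/toS1_eq/eqZ_sym.
  have [n en] := eqZ_fracR (repr (h (toS1 (x0 + x))) - y0).
  by exists n; rewrite -addrA -en addrC subrK.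
have phi01 x : 0 <= phi x < 1 by exact: fracR_itv.
have phiU x t : 0 <= t < 1 -> toS1 (y0 + t) = h (toS1 (x0 + x)) -> phi x = t.
  rewrite -phiE => /andP[t0 t1] /toS1_eq/eqZ_sym[n en].
  have /andP[f0 f1] := phi01 x; apply: eqZ_eq.
    by exists n; apply: (addrI y0); rewrite en addrA.
  by rewrite ltr_norml; apply/andP; split; lra.
have phi_gt0 x : 0 < x < 1 -> 0 < phi x.
  move=> /andP[x0' x1]; have /andP[f0 f1] := phi01 x.
  rewrite lt_neqAle f0 andbT eq_sym; apply/eqP => e.
  have := phiE x; rewrite e addr0 -hx0 => /(can_inj hK)/toS1_eq[n en].
  have : eqZ x 0 by exists (- n); rewrite rmorphN/=; lra.
  by move=> /eqZ_eq; rewrite subr0 gtr0_norm// => /(_ x1); lra.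
have phi_inj : {in `]0, 1[ &, injective phi}.
  move=> x y; rewrite !in_itv/= => /andP[x0' x1] /andP[y0' y1] e.
  have := phiE x; rewrite e phiE => /(can_inj hK)/toS1_eq[n en].
  apply: eqZ_eq; first by exists (- n); rewrite rmorphN/=; lra.
  by rewrite ltr_norml; apply/andP; split; lra.
have phi_cont : {within `]0, 1[, continuous phi}.
  apply: continuous_in_subspaceT => x /set_mem /=; rewrite in_itv/= => hx.
  apply/cvgrPdist_lt => eps e0.
  (* Truncation to [[0, 1]] forces the representative found near [y0 + phi x] to be the one that
     [phi] selects. *)
  pose a := Num.max 0 (phi x - eps); pose b := Num.min 1 (phi x + eps).
  have cc : {for x, continuous (fun z => h (toS1 (x0 + z)))}.
    apply: (@continuous_comp _ _ _ (fun z => toS1 (x0 + z)) h); last exact: ch.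
    apply: (@continuous_comp _ _ _ (fun z => x0 + z) (@toS1 R)); last exact: toS1_continuous.
    exact: (cvgD (cvg_cst _) cvg_id).
  have U : nbhs (h (toS1 (x0 + x))) [set p : S1 | exists2 z, y0 + a < z < y0 + b & toS1 z = p].
    apply: open_nbhs_nbhs; split; first exact: toS1_open.
    exists (y0 + phi x); last exact: phiE.
    have /andP[f0 f1] := phi01 x; have := phi_gt0 x hx => f0'.
    by rewrite !ltrD2l /a /b gt_max lt_min f0' f1 ltrBlDr ltrDl e0.
  near=> z.
  have [u hu eu] : exists2 u, y0 + a < u < y0 + b & toS1 u = h (toS1 (x0 + z)).
    by near: z; exact: cc U.
  have /andP[au ub] : a < u - y0 < b by rewrite ltrBrDl ltrBlDl.
  move: au ub; rewrite /a /b gt_max lt_min => /andP[u0 u1] /andP[u2 u3].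
  have -> : phi z = u - y0.
    by apply: phiU; [rewrite (ltW u0)|rewrite addrC subrK].
  by rewrite ltr_norml; apply/andP; split; lra.
(* In the decreasing case [phi] is composed with [1 - x], which on the circle is the reflection
   [- x]; hence [e = -1]. *)
have [e [chi [he chi_gt0 chi_lt1 chi_homo chiE]]] : exists (e : R) chi, [/\ e = 1 \/ e = -1,
    forall x, 0 < x < 1 -> 0 < chi x, forall x, 0 < x < 1 -> chi x < 1,
    {in `]0, 1[ &, {homo chi : x y / x < y}} &
    forall x, toS1 (y0 + chi x) = h (toS1 (x0 + e * x))].
  have [inc|dec] := itv_continuous_inj_mono phi_cont phi_inj.
    exists 1, phi; split=> //; first by left.
      by move=> x _; case/andP: (phi01 x).
    by move=> x; rewrite mul1r.
  exists (-1), (fun x => phi (1 - x)); split=> //; first by right.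
  - by move=> x hx; apply: phi_gt0; lra.
  - by move=> x _; case/andP: (phi01 (1 - x)).
  - move=> x y; rewrite !in_itv/= => hx hy xy; apply: dec; rewrite ?in_itv/=; lra.
  - move=> x; rewrite phiE; congr h; apply/toS1_eq; exists 1.
    by rewrite mulN1r; lra.
(* [chi] is controlled on []0, 1[] only; the value at 0 is imposed by [h (toS1 x0) = toS1 y0]. *)
pose c t := if t == 0 then 0 else chi t.
have cE t : toS1 (y0 + c t) = h (toS1 (x0 + e * t)).
  by rewrite /c; case: eqP => [->|_]; rewrite ?mulr0 ?addr0 ?hx0 ?chiE.
have c01 t : 0 <= t < 1 -> 0 <= c t < 1.
  rewrite /c; case: eqP => [_ _|/eqP t0 /andP[ht t1]]; first by rewrite lexx ltr01.
  have ht' : 0 < t < 1 by rewrite lt_neqAle eq_sym t0 ht.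
  by rewrite ltW ?chi_gt0// chi_lt1.
have c_homo t u : 0 <= t -> t < u -> u < 1 -> c t < c u.
  move=> t0 tu u1; have u0 : 0 < u by exact: le_lt_trans tu.
  rewrite /c (gt_eqF u0); case: eqP => [_|/eqP tn].
    by apply: chi_gt0; rewrite u0.
  have t0' : 0 < t by rewrite lt_neqAle eq_sym tn.
  by apply: chi_homo; rewrite // in_itv/= ?t0' ?u0//=; exact: lt_trans u1.
pose H x := (Num.floor x)%:~R + c (fracR x).
have H_int x (n : int) : H (x + n%:~R) = H x + n%:~R.
  by rewrite /H /fracR floorD_int intrD opprD addrACA subrr addr0; ring.
have HE x : toS1 (y0 + H x) = h (toS1 (x0 + e * x)).
  transitivity (toS1 (y0 + c (fracR x))).
    by apply/toS1_eq; exists (Num.floor x); rewrite /H; ring.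
  rewrite cE; congr h; apply/toS1_eq/eqZ_sym; rewrite /fracR.
  by case: he => ->; [exists (Num.floor x)|exists (- Num.floor x)]; rewrite ?rmorphN/=; ring.
have Hlt x y : x < y -> H x < H y.
  move=> xy; have : Num.floor x <= Num.floor y by apply: le_floor; exact: ltW.
  have /andP[a0 a1] := fracR_itv x; have /andP[b0 b1] := fracR_itv y.
  rewrite le_eqVlt => /orP[/eqP e1|].
    rewrite /H e1 ltrD2l; apply: c_homo => //.
    by rewrite /fracR e1 ltrD2r.
  rewrite -lezD1 => h1.
  have /andP[_ h2] : 0 <= c (fracR x) < 1 by apply: c01; rewrite a0.
  have /andP[h3 _] : 0 <= c (fracR y) < 1 by apply: c01; rewrite b0.
  have : (Num.floor x + 1)%:~R <= (Num.floor y)%:~R :> R by rewrite ler_int.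
  by rewrite intrD /H; lra.
have mH : {mono H : x y / x <= y} by apply: le_mono.
have H0 : H 0 = 0.
  by rewrite /H /fracR /c floor0 subr0 eqxx addr0.
exists e, H; split; last exact: HE.
split=> //; last by move=> x; exact: (H_int x 1).
apply: mono_surj_continuous => // y.
pose x := e * (repr (h' (toS1 (y0 + y))) - x0).
have : toS1 (y0 + H x) = toS1 (y0 + y).
  rewrite HE /x; have -> : x0 + e * (e * (repr (h' (toS1 (y0 + y))) - x0)) =
      repr (h' (toS1 (y0 + y))) by case: he => ->; ring.
  by rewrite toS1_repr h'K.
move=> /toS1_eq/eqZ_sym[n en]; exists (x + n%:~R); rewrite H_int; lra.
Unshelve. all: by end_near. Qed.

(** The degree [d] is the mean of the derivative over a period, so [|d| > 1]. Then [F x - x] changes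
    by [d - 1], at least 1 in absolute value, over [[0, 1]] and meets an integer. *)
Lemma expanding_fixpoint f F F1 gamma : is_lift f F -> derivf F F1 -> 1 < gamma ->
  (forall x, gamma <= `|F1 x|) -> exists x, f (toS1 x) = toS1 x.
Proof.
move=> lF dF g1 gF.
have [d dE] := lift_degree lF.
have dE1 : F 1 = F 0 + d%:~R by rewrite -dE add0r.
have [c _] := mvt_le dF ler01.
rewrite dE1 subr0 mulr1 addrAC subrr add0r => ec.
have := gF c; rewrite -ec => gd.
have [n hn] : exists n : int, Num.min (F 0) (F 0 + d%:~R - 1) <= n%:~R <=
    Num.max (F 0) (F 0 + d%:~R - 1).
  have := floor_itv (F 0); rewrite intrD => /andP[h1 h2].
  have [d0|d0] := ltP 0 d.
    have d2 : (1 + 1)%:~R <= d%:~R :> R.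
      rewrite ler_int lezD1 -(ltr_int R) (lt_le_trans g1)// (le_trans gd)//.
      by rewrite ger0_norm// ler0z ltW.
    rewrite intrD in d2; exists (Num.floor (F 0) + 1).
    by rewrite ge_min le_max intrD; apply/andP; split; apply/orP; [left|right]; lra.
  have d2 : d%:~R <= 0 :> R by rewrite lerz0.
  exists (Num.floor (F 0)); rewrite ge_min le_max.
  by apply/andP; split; apply/orP; [right|left]; lra.
have cD := derivfB dF (@derivf_id R).
have [||x _ ex] := @IVT _ (fun x => F x - x) 0 1 n%:~R ler01.
- by apply: continuous_subspaceT => z; exact: derivf_continuous cD z.
- by rewrite subr0 dE1.
- exists x; case: lF => _ lF; rewrite -lF; apply/toS1_eq; exists n; lra.
Qed.

End Conjugacy.

(** * Lifts centred at a fixed point *)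

Section NormalizedLift.
Variable R : realType.
Local Notation S1 := (circle R).
Implicit Types (f g : S1 -> S1) (F : R -> R).

Lemma is_lift_iter f F N : is_lift f F -> is_lift (iter N f) (iter N F).
Proof.
move=> [cF lF]; elim: N => [|N [cN lN]] /=; first by split=> // x; exact: cvg_id.
split=> [x|x]; last by rewrite lF lN.
by apply: (@continuous_comp _ _ _ (iter N F) F x); [exact: cN|exact: cF].
Qed.

Lemma derivf_iter F F1 N : derivf F F1 -> derivf (iter N F) (iter_deriv N F F1).
Proof.
move=> dF; elim: N => [|N IH]; first exact: derivf_id.
apply: (derivf_ext (derivf_comp IH dF)) => x; first by rewrite iterSr.
by rewrite mulrC.
Qed.

Lemma sg_degree (d : int) : sg R (d < 0) * `|d|%N%:R = d%:~R.
Proof. by rewrite {3}[d]intEsign rmorphM/= rmorphXn/= rmorphN1. Qed.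

Variables (f : S1 -> S1) (F F1 F2 : R -> R) (gamma M : R) (d : int) (x0 e : R).
Hypotheses (lF : is_lift f F) (sF : smooth 2 F).
Hypotheses (dF : derivf F F1) (dF1 : derivf F1 F2).
Hypotheses (gamma1 : 1 < gamma) (F1_ge : forall x, gamma <= `|F1 x|).
Hypotheses (F1_le : forall x, `|F1 x| <= M) (F2_le : forall x, `|F2 x| <= M).
Hypothesis degF : forall x, F (x + 1) = F x + d%:~R.
Hypotheses (fix0 : f (toS1 x0) = toS1 x0) (e1 : e = 1 \/ e = -1).

(** Coordinate centred at the fixed point [x0] and oriented by [e]. Subtracting [F x0], which
    differs from [x0] by an integer, keeps it a lift and makes 0 fixed; as [e * e = 1], the
    derivative keeps its sign. *)
Definition recenter x := e * (F (x0 + e * x) - F x0).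
Definition drecenter x := F1 (x0 + e * x).

Let ee : e * e = 1. Proof. by case: e1 => ->; ring. Qed.

Lemma recenter_deriv : derivf recenter drecenter.
Proof.
have dA := derivfD (derivf_cst x0) (derivfZ e (@derivf_id R)).
apply: (derivf_ext (derivfZ e (derivfB (derivf_comp dF dA) (derivf_cst (F x0))))) => // x.
by rewrite add0r mulr1 subr0 mulrCA ee mulr1.
Qed.

Lemma recenter_lift : lift gamma M (d < 0) `|d| recenter drecenter.
Proof.
have per x : recenter (x + 1) = recenter x + d%:~R.
  rewrite /recenter; case: e1 => ->.
    by rewrite !mul1r addrA degF addrAC.
  have -> : x0 + -1 * x = (x0 + -1 * (x + 1)) + 1 by ring.
  by rewrite degF; ring.
have zero : recenter 0 = 0 by rewrite /recenter mulr0 addr0 subrr mulr0.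
have contF1 : continuous drecenter.
  move=> x; apply: (@continuous_comp _ _ _ (fun x => x0 + e * x) F1 x).
    exact: derivf_continuous (derivfD (derivf_cst x0) (derivfZ e (@derivf_id R))) x.
  exact: derivf_continuous dF1 _.
have gamma0 : 0 < gamma by apply: lt_trans gamma1.
have ge x : gamma <= `|drecenter x| by exact: F1_ge.
(* At some [c] the derivative equals the degree, whose sign is known; never vanishing, it keeps that
   sign everywhere. *)
have pos x : 0 <= sg R (d < 0) * drecenter x.
  have [c _] := mvt_le recenter_deriv ler01.
  have r1 := per 0; rewrite zero !add0r in r1.
  rewrite r1 zero !subr0 mulr1 => ec.
  rewrite leNgt; apply/negP => neg.
  have posc : 0 <= sg R (d < 0) * drecenter c.
    by rewrite -ec -sg_degree mulrA sgM mul1r ler0n.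
  have cont : continuous (fun x => sg R (d < 0) * drecenter x).
    by move=> z; exact: (cvgM (cvg_cst _) (contF1 z)).
  have key a b : a <= b -> Num.min (sg R (d < 0) * drecenter a) (sg R (d < 0) * drecenter b)
      <= 0 <= Num.max (sg R (d < 0) * drecenter a) (sg R (d < 0) * drecenter b) -> False.
    move=> ab h; have [|z _ /eqP] := @IVT _ (fun x => sg R (d < 0) * drecenter x) a b 0 ab _ h.
      by apply: continuous_subspaceT => z; exact: cont.
    rewrite mulf_eq0 /sg signr_eq0 /= => /eqP z0.
    by have := ge z; rewrite z0 normr0 leNgt gamma0.
  have [xc|/ltW cx] := leP x c.
    by apply: (key _ _ xc); rewrite ge_min le_max (ltW neg) posc orbT.
  by apply: (key _ _ cx); rewrite ge_min le_max (ltW neg) posc !orbT.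
split=> //.
- exact: recenter_deriv.
- apply: smoothM; first exact: smooth_cst.
  apply: smoothD; last exact: smooth_cst.
  apply: (smooth_comp sF); apply: smoothD; first exact: smooth_cst.
  by apply: smoothM; [exact: smooth_cst|exact: smooth_id].
- by move=> x; rewrite per sg_degree.
- move=> x; apply: (le_trans (ge x)).
  by rewrite -[leRHS]ger0_norm// normrM norm_sg mul1r.
- by move=> x; exact: F1_le.
- move=> x y; apply: (le_trans (derivf_lipschitz dF1 F2_le _ _)).
  rewrite opprD addrACA subrr add0r -mulrBr normrM.
  by case: e1 => ->; rewrite ?normrN normr1 mul1r.
Qed.

Lemma eqZ_recenter x : eqZ (x0 + e * recenter x) (F (x0 + e * x)).
Proof.
have [n en] : eqZ (F x0) x0 by apply/toS1_eq; case: lF => _ ->.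
by exists (- n); rewrite /recenter mulrA ee mul1r rmorphN/= en; ring.
Qed.

Lemma toS1_recenter x : toS1 (x0 + e * recenter x) = f (toS1 (x0 + e * x)).
Proof. by case: lF => _ <-; apply/toS1_eq; exact: eqZ_recenter. Qed.

Lemma toS1_iter_recenter N x :
  toS1 (x0 + e * iter N recenter x) = iter N f (toS1 (x0 + e * x)).
Proof. by elim: N => //= N IH; rewrite toS1_recenter IH. Qed.

Lemma toS1_eqZ x y : eqZ x y -> toS1 (x0 + e * x) = toS1 (x0 + e * y).
Proof.
move=> [n ->]; apply/toS1_eq.
by case: e1 => ->; [exists n|exists (- n); rewrite rmorphN/=]; ring.
Qed.

Lemma derivc_recenter x : derivc 1 f (toS1 (x0 + e * x)) = drecenter x.
Proof. exact: derivc_lift lF dF _. Qed.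

Lemma iter_deriv_recenter N x :
  iter_deriv N recenter drecenter x = derivc 1 (iter N f) (toS1 (x0 + e * x)).
Proof.
rewrite (derivc_lift (is_lift_iter N lF) (derivf_iter N dF)).
(* The two orbits agree only modulo integers, so the induction allows any representative [z]. *)
suff h z : toS1 z = toS1 (x0 + e * x) ->
   iter_deriv N recenter drecenter x = iter_deriv N F F1 z by exact: h.
elim: N x z => //= N IH x z hz; congr (_ * _).
  by rewrite -derivc_recenter -hz (derivc_lift lF dF).
by apply: IH; rewrite toS1_recenter -hz; case: lF.
Qed.

End NormalizedLift.

(** * Distances and maps on the circle *)

Section CircleDistances.
Variable R : realType.
Local Notation S1 := (circle R).
Implicit Types (f g : S1 -> S1).

Lemma cdist_ge0 (p q : S1) : 0 <= cdist p q.
Proof.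
apply: lb_le_inf; first by exists `|repr p - repr q|, (repr p), (repr q); rewrite !toS1_repr.
by move=> _ [a [b [_ _ ->]]]; exact: normr_ge0.
Qed.

Lemma dC2_bounds f g C0 : (dC 2 f g < C0%:E)%E ->
  forall p, `|derivc 1 f p - derivc 1 g p| <= C0 /\ `|derivc 2 f p - derivc 2 g p| <= C0.
Proof.
rewrite /dC big_nat_recr//= big_nat1 => h p.
move: h; set S0 := dC0 f g; set S1' := ereal_sup _; set S2' := ereal_sup _ => h.
have u1 : (`|derivc 1 f p - derivc 1 g p|%:E <= S1')%E.
  by apply: ereal_sup_ubound; exists p.
have u2 : (`|derivc 2 f p - derivc 2 g p|%:E <= S2')%E.
  by apply: ereal_sup_ubound; exists p.
have n0 : (0 <= S0)%E.
  apply: (@le_trans _ _ (cdist (f p) (g p))%:E); first by rewrite lee_fin cdist_ge0.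
  by apply: ereal_sup_ubound; exists p.
have n1 : (0 <= S1')%E by apply: le_trans u1; rewrite lee_fin.
have n2 : (0 <= S2')%E by apply: le_trans u2; rewrite lee_fin.
split; rewrite -lee_fin.
  apply: (le_trans u1); apply: le_trans (ltW h).
  by rewrite addeA -[leLHS]adde0 leeD// leeDr.
apply: (le_trans u2); apply: le_trans (ltW h).
by rewrite addeA leeDr// adde_ge0.
Qed.

Lemma dC1_le f g a : (forall p, cdist (f p) (g p) <= a) ->
  (forall p, `|derivc 1 f p - derivc 1 g p| <= a) -> (dC 1 f g <= (2 * a)%:E)%E.
Proof.
move=> h0 h1; rewrite /dC big_nat1 mulr_natl mulr2n EFinD; apply: leeD.
  by apply: ge_ereal_sup => _ [p _ <-]; rewrite lee_fin.
by apply: ge_ereal_sup => _ [p _ <-]; rewrite lee_fin.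
Qed.

Definition circle_map (Phi : R -> R) (p : S1) : S1 := toS1 (Phi (repr p)).

Lemma circle_mapE (Phi : R -> R) x : (forall x y, eqZ x y -> eqZ (Phi x) (Phi y)) ->
  circle_map Phi (toS1 x) = toS1 (Phi x).
Proof.
by move=> h; apply/toS1_eq; apply: h; apply/toS1_eq; rewrite toS1_repr.
Qed.

Lemma translation_eqZ (P : R -> R) : (forall x, P (x + 1) = P x + 1) ->
  forall x y, eqZ x y -> eqZ (P x) (P y).
Proof.
by move=> pP x y [n ->]; exists n; exact: translation_int.
Qed.

End CircleDistances.

Lemma min_expansion_rate_le (R : realType) (g : circle R -> circle R) p :
  min_expansion_rate g <= `|derivc 1 g p|.
Proof.
apply: ge_inf; last by exists p.
by exists 0 => _ [q _ <-]; exact: normr_ge0.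
Qed.

Lemma Ck2_lift (R : realType) (f : circle R -> circle R) : Ck 2 f ->
  exists F F1 F2, [/\ is_lift f F, smooth 2 F, derivf F F1, derivf F1 F2 & continuous F2].
Proof.
move=> [F [lF /CkR_smooth sF]]; have [F1 dF [F2 dF1 cF2]] := sF.
by exists F, F1, F2.
Qed.

Lemma Ck2_bounded (R : realType) (g : circle R -> circle R) : Ck 2 g ->
  exists2 M, 0 <= M & forall p, `|derivc 1 g p| <= M /\ `|derivc 2 g p| <= M.
Proof.
move=> /Ck2_lift[G [G1 [G2 [lG sG dG dG1 cG2]]]].
have E1 := derivc_lift lG dG; have E2 := derivc2_lift lG dG dG1.
have tp x : toS1 (x + 1) = toS1 x :> circle R by apply/toS1_eq; exists 1.
have [|M1 M10 h1] := periodic_bounded (derivf_continuous dG1).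
  by move=> x; rewrite -!E1 tp.
have [|M2 M20 h2] := periodic_bounded cG2.
  by move=> x; rewrite -!E2 tp.
exists (M1 + M2); first by rewrite addr_ge0.
move=> p; rewrite -(toS1_repr p) E1 E2; split.
  by apply: (le_trans (h1 _)); rewrite lerDl.
by apply: (le_trans (h2 _)); rewrite lerDr.
Qed.

Theorem theorem1p3 (R : realType) (g : circle R -> circle R)
    (g_C2 : Ck 2 g) (g_expanding : expanding g)
    (C0 gamma : R) (C0_gt0 : 0 < C0) (gamma_gt1 : 1 < gamma) :
  exists (K lambda : R) (K' : R -> R),
    [/\ 0 < K,
        0 < lambda < 1,
        (forall lambda0 : R, Num.sqrt lambda < lambda0 < 1 -> 0 < K' lambda0) &
    forall (f h : circle R -> circle R) (N : nat),
      Exp 2 gamma f ->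
      (dC 2 f g < C0%:E)%E ->
      homeomorphism h ->
      h \o f = g \o h ->
      (forall p, Fix (iter N f) p ->
         derivc 1 (iter N f) p = derivc 1 (iter N g) (h p)) ->
      exists hN hN_inv : circle R -> circle R,
        [/\ diffeomorphism 2 hN hN_inv,
            (dC0 h hN <= (K * lambda ^+ N)%:E)%E &
            forall lambda0 : R, Num.sqrt lambda < lambda0 < 1 ->
              (dC 1 f (hN_inv \o g \o hN) <= (K' lambda0 * lambda0 ^+ N)%:E)%E]].
Proof.
have [Mg Mg0 gb] := Ck2_bounded g_C2.
have [G [G1 [G2 [lG sG dG dG1 cG2]]]] := Ck2_lift g_C2.
have EG1 := derivc_lift lG dG; have EG2 := derivc2_lift lG dG dG1.
(* [f] and [g] must share one contraction rate, and [g] is not assumed to expand by [gamma]. *)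
pose gam := Num.min gamma (min_expansion_rate g).
have gam1 : 1 < gam by rewrite lt_min gamma_gt1; case: g_expanding.
(* [Mg + C0] bounds the first two derivatives of every admissible [f]; the 1 ensures [1 <= M]. *)
pose M := Mg + C0 + 1.
have M1 : 1 <= M by rewrite lerDr addr_ge0// ltW.
have [K [K1 [lam [K0 K10 /andP[lam0 lam1] approx]]]] := lift_approx gam1 M1.
(* The rate obtained is [Num.sqrt lam] itself, so one constant serves every [lambda0]; the 2 counts
   the two terms of the [C^1] distance. *)
exists K, lam, (fun=> 2 * K1); split=> //; first by rewrite lam0.
  by move=> *; rewrite mulr_gt0.
move=> f h N [f_C2 _ f_ge] fg_close hh hfgh matched.
have [F [F1 [F2 [lF sF dF dF1 cF2]]]] := Ck2_lift f_C2.
have EF1 := derivc_lift lF dF; have EF2 := derivc2_lift lF dF dF1.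
have conj p : h (f p) = g (h p) := congr1 (@^~ p) hfgh.
have F1_ge x : gam <= `|F1 x|.
  by rewrite -EF1; apply: le_trans (f_ge _); rewrite ge_min lexx.
have G1_ge x : gam <= `|G1 x|.
  by rewrite -EG1; apply: le_trans (min_expansion_rate_le g _); rewrite ge_min lexx orbT.
have near_g i p : `|derivc i g p| <= Mg -> `|derivc i f p - derivc i g p| <= C0 ->
    `|derivc i f p| <= M.
  move=> h1 h2; rewrite -[derivc i f p](subrK (derivc i g p)).
  by apply: (le_trans (ler_normD _ _)); rewrite /M; lra.
have F1_le x : `|F1 x| <= M.
  rewrite -EF1; apply: near_g; first by case: (gb (toS1 x)).
  by case: (dC2_bounds fg_close (toS1 x)).
have F2_le x : `|F2 x| <= M.
  rewrite -EF2; apply: near_g; first by case: (gb (toS1 x)).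
  by case: (dC2_bounds fg_close (toS1 x)).
have MgM : Mg <= M by rewrite /M; lra.
have G1_le x : `|G1 x| <= M.
  by rewrite -EG1 (le_trans _ MgM)//; case: (gb (toS1 x)).
have G2_le x : `|G2 x| <= M.
  by rewrite -EG2 (le_trans _ MgM)//; case: (gb (toS1 x)).
have [x0 fix0] := expanding_fixpoint lF dF gam1 F1_ge.
have [y0 hy0] : exists y0, h (toS1 x0) = toS1 y0.
  by exists (repr (h (toS1 x0))); rewrite toS1_repr.
have gfix0 : g (toS1 y0) = toS1 y0 by rewrite -hy0 -conj fix0.
have [e [H [[he mH cH H0 pH] HE]]] := homeo_lift hh hy0.
have ee : e * e = 1 by case: he => ->; ring.
have [df degF] := lift_degree lF; have [dg degG] := lift_degree lG.
have one1 : (1 : R) = 1 \/ (1 : R) = -1 by left.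
(* The orientation of [h] is put entirely into the coordinate of [f], so that [H] is increasing. *)
pose Fh := recenter F x0 e; pose fh := drecenter F1 x0 e.
pose Gh := recenter G y0 1; pose gh := drecenter G1 y0 1.
have FL : lift gam M (df < 0) `|df| Fh fh.
  exact: recenter_lift sF dF dF1 gam1 F1_ge F1_le F2_le degF he.
have GL : lift gam M (dg < 0) `|dg| Gh gh.
  exact: recenter_lift sG dG dG1 gam1 G1_ge G1_le G2_le degG one1.
have Fpi x : toS1 (x0 + e * Fh x) = f (toS1 (x0 + e * x)).
  exact: toS1_recenter lF fix0 he x.
have Gpi y : toS1 (y0 + Gh y) = g (toS1 (y0 + y)).
  by have := toS1_recenter lG gfix0 one1 y; rewrite !mul1r.
(* On the circle the conjugacy is known, so the difference is continuous and integer-valued; it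
   vanishes at 0. *)
have Hconj x : H (Fh x) = Gh (H x).
  have cF := derivf_continuous (lift_deriv FL).
  have cG := derivf_continuous (lift_deriv GL).
  have cD : continuous (fun x => H (Fh x) - Gh (H x)).
    move=> z; apply: (cvgB (f := fun x => H (Fh x)) (g := fun x => Gh (H x))).
      exact: (@continuous_comp _ _ _ Fh H z (cF z) (cH _)).
    exact: (@continuous_comp _ _ _ H Gh z (cH z) (cG _)).
  have DZ z : eqZ (H (Fh z) - Gh (H z)) 0.
    have /toS1_eq[n en] : toS1 (y0 + H (Fh z)) = toS1 (y0 + Gh (H z)).
      by rewrite HE Fpi conj Gpi HE.
    by exists n; rewrite add0r; lra.
  have := eqZ_valued_const cD DZ x.
  rewrite /= (lift_zero FL) H0 (lift_zero GL) subrr => /eqP.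
  by rewrite subr_eq0 => /eqP.
have same_deg : dg = df.
  have h1 := Hconj (0 + 1); have h2 := Hconj 0.
  rewrite (lift_per FL) pH (lift_per GL) !sg_degree (translation_int pH) h2 in h1.
  by move/addrI/intr_inj: h1.
rewrite same_deg in GL.
have hmatch p : eqZ (iter N Fh p) p ->
    iter_deriv N Fh fh p = iter_deriv N Gh gh (H p).
  move=> hp; rewrite (iter_deriv_recenter lF dF fix0 he).
  rewrite (iter_deriv_recenter lG dG gfix0 one1) mul1r HE.
  apply: matched; rewrite /Fix /= -(toS1_iter_recenter lF fix0 he).
  exact: toS1_eqZ.
have [P [Pi [fn [[PK PiK sP sPi pP] [Pclose dfn FnC0 FnC1]]]]] :=
  approx _ _ _ _ _ _ _ N FL GL mH H0 pH Hconj hmatch.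
have pPi x : Pi (x + 1) = Pi x + 1.
  by apply: (can_inj PK); rewrite PiK pP PiK.
(* [P] and [Pi] in the original coordinates; for [e = -1] both lifts are decreasing. *)
pose A x := y0 + P (e * (x - x0)); pose B y := x0 + e * Pi (y - y0).
have eZ x y : eqZ x y -> eqZ (e * (x - x0)) (e * (y - x0)).
  move=> [n ->]; case: he => ->; [exists n|exists (- n)]; rewrite ?rmorphN/=; ring.
have AZ x y : eqZ x y -> eqZ (A x) (A y).
  move=> /eZ/(translation_eqZ pP)[n en]; exists n; rewrite /A en; ring.
have BZ x y : eqZ x y -> eqZ (B x) (B y).
  move=> [m em]; have /(translation_eqZ pPi)[n en] : eqZ (x - y0) (y - y0).
    by exists m; rewrite em; ring.
  rewrite /B en; case: he => ->; [exists n|exists (- n)]; rewrite ?rmorphN/=; ring.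
have AB x : A (B x) = x.
  rewrite /A /B; have -> : e * (x0 + e * Pi (x - y0) - x0) = (e * e) * Pi (x - y0) by ring.
  by rewrite ee mul1r PiK; ring.
have BA x : B (A x) = x.
  rewrite /A /B; have -> : y0 + P (e * (x - x0)) - y0 = P (e * (x - x0)) by ring.
  by rewrite PK mulrA ee; ring.
have sA : smooth 2 A.
  apply: smoothD; first exact: smooth_cst.
  apply: (smooth_comp sP).
  by apply: (smooth_ext (smooth_affine 2 e (- (e * x0)))) => x; ring.
have sB : smooth 2 B.
  apply: smoothD; first exact: smooth_cst.
  apply: smoothM; first exact: smooth_cst.
  apply: (smooth_comp sPi).
  by apply: (smooth_ext (smooth_affine 2 1 (- y0))) => x; ring.
pose hN := circle_map A; pose hNi := circle_map B.
have hNE x : hN (toS1 x) = toS1 (A x) by exact: circle_mapE.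
have hNiE x : hNi (toS1 x) = toS1 (B x) by exact: circle_mapE.
have smooth_lift n U : smooth n.+1 U -> continuous U.
  by move=> [u du _]; exact: derivf_continuous du.
have coord p : exists t, p = toS1 (x0 + e * t).
  exists (e * (repr p - x0)); rewrite mulrA ee mul1r [x0 + _]addrC subrK.
  by rewrite toS1_repr.
have fNE t : (hNi \o g \o hN) (toS1 (x0 + e * t)) = toS1 (x0 + e * Pi (Gh (P t))).
  rewrite /= hNE /A; have -> : e * (x0 + e * t - x0) = (e * e) * t by ring.
  rewrite ee mul1r -Gpi hNiE /B.
  by have -> : y0 + Gh (P t) - y0 = Gh (P t) by ring.
exists hN, hNi; split.
- split.
  + by move=> p; rewrite -(toS1_repr p) hNE hNiE BA.
  + by move=> p; rewrite -(toS1_repr p) hNiE hNE AB.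
  + exists A; split; last exact: smooth_CkR.
    by split; [exact: smooth_lift sA|move=> x; rewrite hNE].
  + exists B; split; last exact: smooth_CkR.
    by split; [exact: smooth_lift sB|move=> x; rewrite hNiE].
- apply: ge_ereal_sup => _ [p _ <-]; rewrite lee_fin.
  have [t ->] := coord p.
  rewrite hNE /A; have -> : e * (x0 + e * t - x0) = (e * e) * t by ring.
  rewrite ee mul1r -HE; apply: (le_trans (cdist_le _ _)).
  by rewrite opprD addrACA subrr add0r distrC; exact: Pclose.
- move=> lam' /andP[hl _].
  have s0 : 0 <= Num.sqrt lam by exact: sqrtr_ge0.
  apply: (@le_trans _ _ (2 * (K1 * Num.sqrt lam ^+ N))%:E); last first.
    rewrite lee_fin -mulrA ler_wpM2l// ler_wpM2l ?(ltW K10)//.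
    by rewrite lerXn2r ?nnegrE ?(ltW hl)// (le_trans s0 (ltW hl)).
  have dFN : derivf (fun x => x0 + e * Pi (Gh (P (e * (x - x0)))))
      (fun x => 0 + e * (fn (e * (x - x0)) * (e * (1 - 0)))).
    apply: derivfD; first exact: derivf_cst.
    apply: derivfZ; apply: (derivf_comp dfn); apply: derivfZ.
    apply: derivfB; [exact: derivf_id|exact: derivf_cst].
  have lFN : is_lift (hNi \o g \o hN) (fun x => x0 + e * Pi (Gh (P (e * (x - x0))))).
    split; first exact: derivf_continuous dFN.
    move=> x; rewrite -fNE; congr ((hNi \o g \o hN) (toS1 _)).
    by rewrite mulrA ee; ring.
  apply: dC1_le => p; have [t ->] := coord p.
    rewrite fNE -Fpi; apply: (le_trans (cdist_le _ _)).
    rewrite opprD addrACA subrr add0r -mulrBr normrM.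
    have -> : `|e| = 1 by case: he => ->; rewrite ?normrN normr1.
    by rewrite mul1r; exact: FnC0.
  rewrite (derivc_lift lFN dFN) EF1 -[F1 _]/(fh t).
  have -> : e * (x0 + e * t - x0) = (e * e) * t by ring.
  have -> : 0 + e * (fn (e * e * t) * (e * (1 - 0))) = (e * e) * fn (e * e * t) by ring.
  by rewrite ee !mul1r; exact: FnC1.
Qed.
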